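(* The constructions $G\mapsto(\mathrm{Bis}\,G,G^{(0)},\gamma^G)$ (slice action of an étale groupoid) and $[\varphi,\psi]\mapsto\big(\psi\circ\varphi^{-1},\ \varphi^{(0)}\circ(\psi^{(0)})^{-1}\big)$ (for couple morphisms $[\varphi,\psi]=[\varphi,\psi;K]\colon G\to H$) form a functor from the category $\mathbf{EG}$ of étale groupoids and equivalence classes of couple morphisms to the category $\mathbf{ISA}$ of inverse semigroup actions and action morphisms.
   Context: The category $\mathbf{ISA}$. A partial map $f\colon X\supset D_f\to Y$ is a continuous map from an open subspace $D_f\subset X$ to $Y$; $f^{-1}(V):=\{x\in D_f:f(x)\in V\}$; $f_2\circ f_1$ has domain $f_1^{-1}(D_{f_2})$. An inverse semigroup is a semigroup $S$ in which every $s$ has a unique $s^*$ with $ss^*s=s$, $s^*ss^*=s^*$. $I(X)$ is the inverse semigroup of homeomorphisms between open subspaces of $X$. An inverse semigroup action $(S,X,\alpha)$ is an inverse semigroup $S$, a topological space $X$ and a semigroup homomorphism $\alpha\colon S\to I(X)$ with $\bigcup_sD^\alpha_s=X$, $D^\alpha_s$ being the domain of $\alpha_s$. An action morphism $(\theta,\xi)\colon(S,X,\alpha)\to(T,Y,\beta)$ is a semigroup homomorphism $\theta\colon S\to T$ and a partial map $\xi\colon Y\supset D_\xi\to X$ with (i) $\xi^{-1}(D^\alpha_s)=D^\beta_{\theta(s)}$ for all $s\in S$; (ii) $\alpha_s(\xi(y))=\xi(\beta_{\theta(s)}(y))$ for all $s\in S$, $y\in\xi^{-1}(D^\alpha_s)$.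 Composition: $(\theta_2,\xi_2)\cdot(\theta_1,\xi_1)=(\theta_2\circ\theta_1,\xi_1\circ\xi_2)$; identities $(\mathrm{id}_S,\mathrm{id}_X)$. The category $\mathbf{EG}$. A groupoid $G$ has unit space $G^{(0)}\subset G$, domain and range maps $d,r$; $g'g$ is defined iff $d(g')=r(g)$; $G_u:=d^{-1}(u)$. A topological groupoid (continuous multiplication and inversion) is étale if $d\colon G\to G^{(0)}$ is a local homeomorphism. For a groupoid homomorphism $\varphi\colon G\to H$, $\varphi^{(0)}\colon G^{(0)}\to H^{(0)}$ and $\varphi_u\colon G_u\to H_{\varphi(u)}$ are its restrictions; $\varphi$ is fibrewise bijective if all $\varphi_u$ are bijective. A couple morphism $(\varphi,\psi;K)\colon G\to H$ of étale groupoids consists of an étale groupoid $K$, a continuous fibrewise bijective homomorphism $\varphi\colon K\to G$ and a continuous homomorphism $\psi\colon K\to H$ with $\psi^{(0)}$ open and injective. $(\varphi_1,\psi_1;K_1)$ and $(\varphi_2,\psi_2;K_2)$ are equivalent if there is a homeomorphic groupoid isomorphism $\iota\colon K_1\to K_2$ with $\varphi_2\circ\iota=\varphi_1$, $\psi_2\circ\iota=\psi_1$; $[\varphi,\psi;K]$ (or $[\varphi,\psi]$) is the equivalence class. Composition of $[\varphi_1,\psi_1;K_1]\colon G_1\to G_2$ and $[\varphi_2,\psi_2;K_2]\colon G_2\to G_3$ is $[\varphi_1\circ\widetilde{\varphi_2},\psi_2\circ\widetilde{\psi_1};K_1\times_{G_2}K_2]$, with $K_1\times_{G_2}K_2=\{(k_1,k_2):\psi_1(k_1)=\varphi_2(k_2)\}$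 (component-wise structure, topology from the product), $\widetilde{\varphi_2}(k_1,k_2)=k_1$, $\widetilde{\psi_1}(k_1,k_2)=k_2$; identities $[\mathrm{id}_G,\mathrm{id}_G;G]$. Slice actions. A bisection of $G$ is a subset $U$ on which $d$ and $r$ are injective. $\mathrm{Bis}\,G$ is the inverse semigroup of open bisections of the étale groupoid $G$ with product $UV=\{uv:u\in U,v\in V,d(u)=r(v)\}$. For $U\in\mathrm{Bis}\,G$, $\gamma^G_U:=r|_U\circ(d|_U)^{-1}\colon d(U)\to r(U)$; this gives the slice action $(\mathrm{Bis}\,G,G^{(0)},\gamma^G)$. For a couple morphism $(\varphi,\psi;K)\colon G\to H$, $\psi\circ\varphi^{-1}$ denotes the map $\mathrm{Bis}\,G\to\mathrm{Bis}\,H$, $U\mapsto\psi(\varphi^{-1}(U))$, and $\varphi^{(0)}\circ(\psi^{(0)})^{-1}$ denotes the partial map $H^{(0)}\supset\psi^{(0)}(K^{(0)})\to G^{(0)}$. *)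

(* Defs.v *)
From HB Require Import structures.
From mathcomp Require Import all_boot all_classical.
From mathcomp Require Import topology_structure initial_topology.
From mathcomp Require Import product_topology subtype_topology.

Set Implicit Arguments.
Unset Strict Implicit.
Unset Printing Implicit Defensive.

Local Open Scope classical_set_scope.

(** A subset [A : set X] used as a type is [set_type A], which carries the
    subspace topology; [\val] is the inclusion. *)

Definition homeomorphism (X Y : topologicalType) (f : X -> Y) : Prop :=
  continuous f /\
  exists g : Y -> X, [/\ continuous g, cancel f g & cancel g f].

Definition open_map (X Y : topologicalType) (f : X -> Y) : Prop :=
  forall U : set X, open U -> open (f @` U).

Definition open_embedding (X Y : topologicalType) (f : X -> Y) : Prop :=
  exists (V : set Y) (f' : X -> V),
    [/\ open V, homeomorphism f' & forall x, \val (f' x) = f x].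

Definition local_homeomorphism (X Y : topologicalType) (f : X -> Y) : Prop :=
  forall x, exists U : set X,
    [/\ open U, U x & open_embedding (fun y : U => f (\val y))].

Lemma val_in (X : Type) (A : set X) (x : A) : A (\val x).
Proof. exact: set_mem (valP x). Qed.

Section SubspaceFacts.
Context {X Y : topologicalType}.
Implicit Types (A : set X) (f : X -> Y).

Lemma set_type_inj A (x y : A) : \val x = \val y -> x = y.
Proof. exact: val_inj. Qed.

Lemma val_continuous A : continuous (fun x : A => \val x).
Proof. exact: (@initial_continuous A X (fun x : A => \val x)). Qed.

Lemma open_subP A (U : set A) :
  open U <-> exists2 O : set X, open O & (fun x : A => \val x) @^-1` O = U.
Proof. by []. Qed.

Lemma continuous_subP A (f : Y -> A) :
  continuous f <-> continuous (fun y => \val (f y)).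
Proof.
split=> cf.
  move=> y; apply: (@continuous_comp _ _ _ f (fun x : A => \val x)).
    exact: cf.
  exact: val_continuous.
apply/continuousP => U [O oO <-].
by move/continuousP: cf => /(_ O oO).
Qed.

Lemma open_val_image A (U : set A) :
  open A -> open U -> open ((fun x : A => \val x) @` U).
Proof.
move=> oA [O oO <-]; have := openI oO oA; congr open; apply/esym.
apply/seteqP; split=> [_ [x Ox <-]|x [Ox Ax]]; first by split; [|exact: val_in].
by exists (exist _ x (mem_set Ax)).
Qed.

Lemma open_mapS f (U : set X) : open_map f -> open U ->
  open_map (fun x : U => f (\val x)).
Proof.
move=> of_ oU W oW.
have := of_ _ (open_val_image oU oW).
by rewrite image_comp.
Qed.

End SubspaceFacts.

Section MapFacts.
Context {X Y : topologicalType}.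
Implicit Types f : X -> Y.

Lemma open_embeddingP f :
  open_embedding f <-> [/\ continuous f, injective f & open_map f].
Proof.
split=> [[V [f' [oV [cf [g [cg fg gf]]] e]]]|[cf injf of_]].
  have -> : f = fun x => \val (f' x) by apply/funext => x; rewrite e.
  split.
  - exact/continuous_subP.
  - by move=> x y /set_type_inj /(can_inj fg).
  move=> U oU; rewrite -[X in open X](image_comp f' (fun x : V => \val x)).
  apply: open_val_image => //.
  move/continuousP: cg => /(_ U oU); congr open.
  by apply/seteqP; split=> [v Uv|_ [x Ux <-]]; [exists (g v)|rewrite /= fg].
have rf x : f x \in range f by apply/mem_set; exists x.
have oR : open (range f) by apply: of_; exact: openT.
pose f' x : range f := exist _ (f x) (rf x).
have pre (v : range f) : {x | f x = \val v}.
  by apply: cid; have [x _ <-] := val_in v; exists x.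
exists (range f), f'; split=> //; split; first exact/continuous_subP.
exists (fun v => sval (pre v)); split.
- apply/continuousP => U oU; exists (f @` U); first exact: of_.
  apply/seteqP; split=> v /=.
    case=> y Uy e; case: (pre v) => x /= e'.
    by have -> : x = y by apply: injf; exact: etrans e' (esym e).
  by case: (pre v) => x /= e Ux; exists x.
- by move=> x; case: (pre (f' x)) => y /= /injf.
- by move=> v; apply: set_type_inj => /=; case: (pre v).
Qed.

Lemma open_local (U : set X) :
  (forall x, U x -> exists V : set X, [/\ open V, V x & V `<=` U]) -> open U.
Proof.
move=> h; rewrite openE => x /h[V [oV Vx VU]].
by rewrite /interior nbhsE; exists V.
Qed.

Lemma continuous_nbhsP f : continuous f <->
  forall x (V : set Y), open V -> V (f x) ->
    exists U : set X, [/\ open U, U x & U `<=` f @^-1` V].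
Proof.
split=> [/continuousP cf x V oV Vfx|h].
  by exists (f @^-1` V); split; [exact: cf| |].
by apply/continuousP => V oV; apply: open_local => x /h; exact.
Qed.

End MapFacts.

Lemma comp_continuous (X Y Z : topologicalType) (f : X -> Y) (g : Y -> Z) :
  continuous f -> continuous g -> continuous (g \o f).
Proof. by move=> cf cg x; apply: continuous_comp; [exact: cf|exact: cg]. Qed.

Lemma local_homeomorphismP (X Y : topologicalType) (f : X -> Y) :
  local_homeomorphism f <->
  [/\ continuous f, open_map f &
      forall x, exists U : set X,
        [/\ open U, U x & forall y z, U y -> U z -> f y = f z -> y = z]].
Proof.
split=> [lf|[cf of_ lf] x].
  split.
  - apply/continuousP => V oV; apply: open_local => x Vfx.
    have [U [oU Ux /open_embeddingP[cU _ _]]] := lf x.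
    exists (U `&` f @^-1` V); split; [|by split|by move=> y []].
    move/continuousP: cU => /(_ V oV) oW.
    have := open_val_image oU oW; congr open.
    apply/seteqP; split=> [_ [y Vy <-]|y [Uy Vy]].
      by split; [exact: val_in|].
    by exists (exist _ y (mem_set Uy)).
  - move=> W oW; apply: open_local => _ [x Wx <-].
    have [U [oU Ux /open_embeddingP[_ _ oU']]] := lf x.
    pose W' : set U := (fun y : U => \val y) @^-1` W.
    have oW' : open W' by exists W.
    exists ((fun y : U => f (\val y)) @` W'); split; first exact: oU'.
      by exists (exist _ x (mem_set Ux)).
    by move=> _ [y W'y <-]; exists (\val y).
  - move=> x; have [U [oU Ux /open_embeddingP[_ iU _]]] := lf x.
    exists U; split=> // y z Uy Uz e.
    have := iU (exist _ y (mem_set Uy)) (exist _ z (mem_set Uz)) e.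
    by move=> /(congr1 (fun y : U => \val y)).
have [U [oU Ux iU]] := lf x; exists U; split=> //; apply/open_embeddingP; split.
- exact: (comp_continuous (@val_continuous _ U) cf).
- by move=> y z /iU e; apply: set_type_inj; apply: e; exact: val_in.
- exact: open_mapS.
Qed.

Section ProductFacts.
Context {X Y Z : topologicalType}.

Lemma fst_continuous : continuous (fst : X * Y -> X).
Proof. by move=> [x y]; exact: cvg_fst. Qed.

Lemma snd_continuous : continuous (snd : X * Y -> Y).
Proof. by move=> [x y]; exact: cvg_snd. Qed.

Lemma pair_continuous (f : Z -> X) (g : Z -> Y) :
  continuous f -> continuous g -> continuous (fun z => (f z, g z)).
Proof. by move=> cf cg z; apply: cvg_pair; [exact: cf|exact: cg]. Qed.

Lemma open_prodP (W : set (X * Y)) (p : X * Y) : open W -> W p ->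
  exists (U : set X) (V : set Y),
    [/\ open U, open V, U p.1, V p.2 &
        forall x y, U x -> V y -> W (x, y)].
Proof.
rewrite openE => /[apply] -[[A B] /= [nA nB] AB].
move: nA nB; rewrite !nbhsE => -[U [oU Ux] UA] [V [oV Vy] VB].
exists U, V; split=> // x y Ux' Vy'; apply: AB; split; [exact: UA|exact: VB].
Qed.

End ProductFacts.

Record partial_map (X Y : topologicalType) := PartialMap {
  pm_dom : set X;
  pm_fun : pm_dom -> Y;
  pm_dom_open : open pm_dom;
  pm_fun_continuous : continuous pm_fun
}.
Arguments pm_fun {X Y} p x.
Arguments pm_dom_open {X Y} p.
Arguments pm_fun_continuous {X Y} p.

(** The partial map [f] is defined at [x], with value [y]. *)
Definition pm_graph (X Y : topologicalType) (f : partial_map X Y) (x : X) (y : Y) : Prop :=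
  exists h : x \in pm_dom f, pm_fun f (exist _ x h) = y.

Definition pm_preimage (X Y : topologicalType) (f : partial_map X Y) (V : set Y) : set X :=
  [set \val x | x in pm_fun f @^-1` V].

Section PartialMapFacts.
Context {X Y : topologicalType}.
Implicit Types f g : partial_map X Y.

Lemma pm_graph_dom f x y : pm_graph f x y -> pm_dom f x.
Proof. by case=> h _; exact: set_mem. Qed.

Lemma pm_graph_ex f x : pm_dom f x -> exists y, pm_graph f x y.
Proof. by move=> /mem_set h; exists (pm_fun f (exist _ x h)), h. Qed.

Lemma pm_graph_val f (x : pm_dom f) : pm_graph f (\val x) (pm_fun f x).
Proof. by case: x => x h; exists h. Qed.

Lemma pm_graph_fun f x y y' : pm_graph f x y -> pm_graph f x y' -> y = y'.
Proof. by move=> [h <-] [h' <-]; rewrite (bool_irrelevance h h'). Qed.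

Lemma pm_preimageP f V x : pm_preimage f V x <-> exists2 y, pm_graph f x y & V y.
Proof.
split=> [[z Vz <-]|[y [h <-] Vy]]; first by exists (pm_fun f z); [exact: pm_graph_val|].
by exists (exist _ x h).
Qed.

Lemma partial_map_eq f g : (forall x y, pm_graph f x y <-> pm_graph g x y) -> f = g.
Proof.
move=> fg.
have dE : pm_dom f = pm_dom g.
  apply/seteqP; split=> x /pm_graph_ex[y] /fg /pm_graph_dom; exact.
case: f g dE fg => [D f oD cf] [D' g oD' cg] /= dE; subst D' => fg.
have fE : f = g.
  apply/funext => -[x h].
  have [h' e] : pm_graph (PartialMap oD' cg) x (f (exist _ x h)) by apply/fg; exists h.
  by move: e => /= <-; rewrite (bool_irrelevance h h').
by subst g; rewrite (Prop_irrelevance oD' oD) (Prop_irrelevance cg cf).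
Qed.

Lemma pm_preimage_dom f V (x : pm_preimage f V) : \val x \in pm_dom f.
Proof. by have [y _ <-] := val_in x; exact: valP. Qed.

Lemma pm_preimage_val f V (x : pm_preimage f V) :
  pm_fun f (exist _ (\val x) (pm_preimage_dom x)) \in V.
Proof.
apply/mem_set; have [y Vy e] := val_in x.
by rewrite (_ : exist _ _ _ = y) //; apply: set_type_inj.
Qed.

Lemma pm_preimage_open f V : open V -> open (pm_preimage f V).
Proof.
move=> oV; apply: open_val_image; first exact: pm_dom_open.
by move/continuousP: (pm_fun_continuous f); exact.
Qed.

End PartialMapFacts.

Section PartialMapComposition.
Context {X Y Z : topologicalType} (g : partial_map Y Z) (f : partial_map X Y).

Definition pm_comp_fun (x : pm_preimage f (pm_dom g)) : Z :=
  pm_fun g (exist _ (pm_fun f (exist _ (\val x) (pm_preimage_dom x))) (pm_preimage_val x)).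

Lemma pm_comp_continuous : continuous pm_comp_fun.
Proof.
pose i (x : pm_preimage f (pm_dom g)) : pm_dom f := exist _ (\val x) (pm_preimage_dom x).
pose j (x : pm_preimage f (pm_dom g)) : pm_dom g := exist _ (pm_fun f (i x)) (pm_preimage_val x).
have ci : continuous i by apply/continuous_subP; exact: val_continuous.
have cj : continuous j.
  by apply/continuous_subP; exact: (comp_continuous ci (pm_fun_continuous f)).
exact: (comp_continuous cj (pm_fun_continuous g)).
Qed.

Definition pm_comp : partial_map X Z :=
  PartialMap (pm_preimage_open f (pm_dom_open g)) pm_comp_continuous.

Lemma pm_compP x z : pm_graph pm_comp x z <-> exists2 y, pm_graph f x y & pm_graph g y z.
Proof.
split=> [[h <-]|[y [h <-] [h' <-]]].
  set x' : pm_preimage f (pm_dom g) := exist _ x h.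
  exists (pm_fun f (exist _ (\val x') (pm_preimage_dom x'))).
    by exists (pm_preimage_dom x').
  by exists (pm_preimage_val x').
have hx : x \in pm_preimage f (pm_dom g).
  by apply/mem_set; exists (exist _ x h) => //=; exact: set_mem.
exists hx; rewrite /= /pm_comp_fun /=; congr (pm_fun _ _); apply: set_type_inj => /=.
by congr (pm_fun _ _); apply: set_type_inj.
Qed.

End PartialMapComposition.

Section RestrictedMap.
Context {X Y : topologicalType} (f : X -> Y) (cf : continuous f).
Context (U : set X) (oU : open U).

Definition pm_restrict : partial_map X Y :=
  PartialMap oU (comp_continuous (@val_continuous X U) cf).

Lemma pm_restrictP x y : pm_graph pm_restrict x y <-> U x /\ f x = y.
Proof.
split=> [[h <-]|[/mem_set h <-]]; last by exists h.
by split; first exact: set_mem.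
Qed.

End RestrictedMap.

Lemma id_continuous (X : topologicalType) : continuous (@id X).
Proof. by move=> x; exact: cvg_id. Qed.

Definition pm_id (X : topologicalType) : partial_map X X :=
  pm_restrict (@id_continuous X) (@openT X).

Lemma pm_idP (X : topologicalType) (x y : X) : pm_graph (pm_id X) x y <-> x = y.
Proof. by split=> [/pm_restrictP[]//|<-]; apply/pm_restrictP. Qed.

Section InversePartialMap.
Context {X Y : topologicalType} (f : partial_map X Y).
Context (injf : injective (pm_fun f)) (openf : open_map (pm_fun f)).

Lemma pm_inv_ex (y : range (pm_fun f)) : exists x : pm_dom f, pm_fun f x = \val y.
Proof. by have [x _ <-] := val_in y; exists x. Qed.

Definition pm_inv_fun (y : range (pm_fun f)) : X := \val (sval (cid (pm_inv_ex y))).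

Lemma pm_inv_continuous : continuous pm_inv_fun.
Proof.
apply/continuousP => O oO.
exists (pm_fun f @` ((fun x : pm_dom f => \val x) @^-1` O)).
  by apply: openf; exists O.
apply/seteqP; split=> y; rewrite /pm_inv_fun /=; case: (cid _) => x /= e.
  by case=> x' Ox' e'; have -> : x = x' by apply: injf; exact: etrans e (esym e').
by move=> Ox; exists x.
Qed.

Definition pm_inv : partial_map Y X := PartialMap (openf (@openT _)) pm_inv_continuous.

Lemma pm_invP y x : pm_graph pm_inv y x <-> pm_graph f x y.
Proof.
split=> [[h <-]|[h <-]].
  rewrite /= /pm_inv_fun; case: (cid _) => x' /= <-; exact: pm_graph_val.
have hy : pm_fun f (exist _ x h) \in range (pm_fun f) by apply/mem_set; exists (exist _ x h).
exists hy; rewrite /= /pm_inv_fun; case: (cid _) => x' /= /injf e.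
by rewrite e.
Qed.

End InversePartialMap.

HB.mixin Record Semigroup_isInverse S of Semigroup S := {
  inverse_unique : forall s : S,
    exists! t : S, (s * t * s)%g = s /\ (t * s * t)%g = t
}.

#[short(type="invSemigroupType")]
HB.structure Definition InverseSemigroup :=
  {S of Semigroup_isInverse S & Semigroup S}.

(** The elements of [I(X)]; an open embedding of [pm_dom f] is a homeomorphism
    of [pm_dom f] onto an open subspace. *)
Record phomeo (X : topologicalType) := PHomeo {
  phomeo_map :> partial_map X X;
  phomeoP : open_embedding (pm_fun phomeo_map)
}.
Arguments phomeoP {X} p.

Section PartialHomeo.
Context {X : topologicalType}.
Implicit Types f g : phomeo X.

Lemma phomeo_eq f g : (forall x y, pm_graph f x y <-> pm_graph g x y) -> f = g.
Proof.
move=> /partial_map_eq; case: f g => [f hf] [g hg] /= e; subst g.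
by rewrite (Prop_irrelevance hf hg).
Qed.

Lemma phomeo_inj f x x' y : pm_graph f x y -> pm_graph f x' y -> x = x'.
Proof.
have /open_embeddingP[_ fi _] := phomeoP f.
by move=> [h <-] [h' /esym/fi []].
Qed.

Lemma open_embedding_graph (f : partial_map X X) :
  (forall x x' y, pm_graph f x y -> pm_graph f x' y -> x = x') ->
  (forall U : set X, open U -> open [set y | exists2 x, U x & pm_graph f x y]) ->
  open_embedding (pm_fun f).
Proof.
move=> fi fo; apply/open_embeddingP; split; first exact: pm_fun_continuous.
  move=> x y e; apply: set_type_inj; apply: (fi _ _ (pm_fun f x)); first exact: pm_graph_val.
  by rewrite e; exact: pm_graph_val.
move=> _ [O oO <-]; have := fo O oO; congr open; apply/seteqP; split.
  by move=> y [x Ox [h <-]]; exists (exist _ x h).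
by move=> _ [x Ox <-]; exists (\val x) => //; exact: pm_graph_val.
Qed.

Lemma phomeo_open f (U : set X) : open U ->
  open [set y | exists2 x, U x & pm_graph f x y].
Proof.
have /open_embeddingP[_ _ fo] := phomeoP f.
move=> oU; pose W : set (pm_dom f) := (fun x : pm_dom f => \val x) @^-1` U.
have oW : open W by exists U.
have := fo W oW; congr open; apply/seteqP; split.
  by move=> _ [x Ox <-]; exists (\val x) => //; exact: pm_graph_val.
by move=> y [x Ox [h <-]]; exists (exist _ x h).
Qed.

Lemma phomeo_comp_subproof f g : open_embedding (pm_fun (pm_comp f g)).
Proof.
apply: open_embedding_graph.
  move=> x x' z /pm_compP[y xy yz] /pm_compP[y' xy' yz'].
  move: xy'; rewrite -(phomeo_inj yz yz') => xy'; exact: phomeo_inj xy xy'.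
move=> U oU; have := phomeo_open f (phomeo_open g oU); congr open.
apply/seteqP; split=> z.
  by move=> [y [x Ux xy] yz]; exists x => //; apply/pm_compP; exists y.
by move=> [x Ux /pm_compP[y xy yz]]; exists y => //; exists x.
Qed.

Definition phomeo_comp f g : phomeo X := PHomeo (phomeo_comp_subproof f g).

Lemma phomeo_compA : associative phomeo_comp.
Proof.
move=> f g h; apply: phomeo_eq => x y; split=> /pm_compP[z].
  move=> /pm_compP[t xt tz] zy; apply/pm_compP; exists t => //.
  by apply/pm_compP; exists z.
move=> xz /pm_compP[t zt ty]; apply/pm_compP; exists t => //.
by apply/pm_compP; exists z.
Qed.

HB.instance Definition _ := gen_eqMixin (phomeo X).
HB.instance Definition _ := gen_choiceMixin (phomeo X).
HB.instance Definition _ := isSemigroup.Build (phomeo X) phomeo_compA.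

Lemma phomeo_mulP f g x z :
  pm_graph (f * g)%g x z <-> exists2 y, pm_graph g x y & pm_graph f y z.
Proof. exact: pm_compP. Qed.

Lemma phomeo_fun_inj f : injective (pm_fun f).
Proof. by have /open_embeddingP[] := phomeoP f. Qed.

Lemma phomeo_fun_open f : open_map (pm_fun f).
Proof. by have /open_embeddingP[] := phomeoP f. Qed.

Lemma phomeo_inv_subproof f :
  open_embedding (pm_fun (pm_inv (@phomeo_fun_inj f) (@phomeo_fun_open f))).
Proof.
apply: open_embedding_graph.
  by move=> y y' x /pm_invP xy /pm_invP; exact: pm_graph_fun.
move=> U oU; have := pm_preimage_open f oU; congr open; apply/seteqP; split=> x.
  by move=> /pm_preimageP[y xy Uy]; exists y => //; apply/pm_invP.
by move=> [y Uy /pm_invP xy]; apply/pm_preimageP; exists y.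
Qed.

Definition phomeo_inv f : phomeo X := PHomeo (phomeo_inv_subproof f).

Lemma phomeo_inverse_unique f :
  exists! g : phomeo X, (f * g * f)%g = f /\ (g * f * g)%g = g.
Proof.
exists (phomeo_inv f); split.
  split; apply: phomeo_eq => x y; split.
  - move=> /phomeo_mulP[z xz /phomeo_mulP[t /pm_invP tz ty]].
    by rewrite (phomeo_inj xz tz).
  - move=> xy; apply/phomeo_mulP; exists y => //; apply/phomeo_mulP.
    by exists x => //; apply/pm_invP.
  - move=> /phomeo_mulP[z /pm_invP zx /phomeo_mulP[t zt ty]].
    by apply/pm_invP; move/pm_invP: ty; rewrite (pm_graph_fun zx zt).
  - move=> yx; apply/phomeo_mulP; exists y => //; apply/phomeo_mulP.
    by exists x => //; move/pm_invP: yx.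
move=> g [fgf gfg]; apply: phomeo_eq => y x; split.
  move=> /pm_invP xy; have : pm_graph (f * g * f)%g x y by rewrite fgf.
  move=> /phomeo_mulP[y2 xy2 /phomeo_mulP[x2 yx2 x2y]].
  by move: yx2; rewrite -(pm_graph_fun xy xy2) -(phomeo_inj xy x2y).
move=> yx; apply/pm_invP.
have : pm_graph (g * f * g)%g y x by rewrite gfg.
move=> /phomeo_mulP[x1 yx1 /phomeo_mulP[y1 x1y1 y1x]].
by rewrite (pm_graph_fun yx yx1) (phomeo_inj yx y1x).
Qed.

HB.instance Definition _ :=
  Semigroup_isInverse.Build (phomeo X) phomeo_inverse_unique.

End PartialHomeo.

Record category := Category {
  obj :> Type;
  hom : obj -> obj -> Type;
  idhom : forall a, hom a a;
  ccomp : forall a b c, hom b c -> hom a b -> hom a c;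
  ccompA : forall a b c d (h : hom c d) (g : hom b c) (f : hom a b),
    ccomp h (ccomp g f) = ccomp (ccomp h g) f;
  ccomp1m : forall a b (f : hom a b), ccomp (idhom b) f = f;
  ccompm1 : forall a b (f : hom a b), ccomp f (idhom a) = f
}.
Arguments hom {_} _ _.
Arguments idhom {_} _.
Arguments ccomp {_ _ _ _} _ _.

Definition is_functor (C D : category) (F0 : C -> D)
    (F1 : forall a b : C, hom a b -> hom (F0 a) (F0 b)) : Prop :=
  (forall a, F1 a a (idhom a) = idhom (F0 a)) /\
  (forall (a b c : C) (g : hom b c) (f : hom a b),
     F1 a c (ccomp g f) = ccomp (F1 b c g) (F1 a b f)).

Record isaction := ISAction {
  isa_semigroup : invSemigroupType;
  isa_space : topologicalType;
  isa_act : isa_semigroup -> phomeo isa_space;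
  isa_actM : {morph isa_act : s t / (s * t)%g};
  isa_cover : \bigcup_s pm_dom (isa_act s) = setT
}.

(** A morphism [(theta, xi)] from [A] to [B]; note that [xi] goes from the space
    of [B] to the space of [A].  The last field says that both
    [alpha_s (xi y)] and [xi (beta_(theta s) y)] are defined and equal. *)
Record action_morphism (A B : isaction) := ActionMorphism {
  am_hom : isa_semigroup A -> isa_semigroup B;
  am_map : partial_map (isa_space B) (isa_space A);
  am_homM : {morph am_hom : s t / (s * t)%g};
  am_dom : forall s, pm_preimage am_map (pm_dom (isa_act s)) = pm_dom (isa_act (am_hom s));
  am_equivariant : forall s y, pm_preimage am_map (pm_dom (isa_act s)) y ->
    exists x, pm_graph (pm_comp (isa_act s) am_map) y x /\
              pm_graph (pm_comp am_map (isa_act (am_hom s))) y x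
}.

Lemma action_morphism_eq (A B : isaction) (m n : action_morphism A B) :
  am_hom m = am_hom n -> am_map m = am_map n -> m = n.
Proof.
case: m n => [h p a b c] [h' p' a' b' c'] /= eh ep; subst h' p'.
by rewrite (Prop_irrelevance a a') (Prop_irrelevance b b') (Prop_irrelevance c c').
Qed.

Section ActionMorphismId.
Context (A : isaction).

Lemma am_id_dom (s : isa_semigroup A) :
  pm_preimage (pm_id (isa_space A)) (pm_dom (isa_act s)) = pm_dom (isa_act s).
Proof.
apply/seteqP; split=> x; first by move=> /pm_preimageP[y /pm_idP <-].
by move=> sx; apply/pm_preimageP; exists x => //; apply/pm_idP.
Qed.

Lemma am_id_equivariant (s : isa_semigroup A) y :
  pm_preimage (pm_id (isa_space A)) (pm_dom (isa_act s)) y ->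
  exists x, pm_graph (pm_comp (isa_act s) (pm_id _)) y x /\
            pm_graph (pm_comp (pm_id _) (isa_act s)) y x.
Proof.
rewrite am_id_dom => /pm_graph_ex[x yx]; exists x; split; apply/pm_compP.
  by exists y => //; apply/pm_idP.
by exists x => //; apply/pm_idP.
Qed.

Definition am_id : action_morphism A A :=
  @ActionMorphism A A id (pm_id _) (fun _ _ => erefl) am_id_dom am_id_equivariant.

End ActionMorphismId.

Section ActionMorphismComp.
Context (A B C : isaction) (n : action_morphism B C) (m : action_morphism A B).

Let h := am_hom n \o am_hom m.
Let p := pm_comp (am_map m) (am_map n).

Lemma am_comp_homM : {morph h : s t / (s * t)%g}.
Proof. by move=> s t; rewrite /h /= !am_homM. Qed.

Lemma am_comp_dom s : pm_preimage p (pm_dom (isa_act s)) = pm_dom (isa_act (h s)).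
Proof.
rewrite /h /= -am_dom -am_dom; apply/seteqP; split=> z.
  move=> /pm_preimageP[x /pm_compP[y zy yx] sx].
  by apply/pm_preimageP; exists y => //; apply/pm_preimageP; exists x.
move=> /pm_preimageP[y zy /pm_preimageP[x yx sx]].
by apply/pm_preimageP; exists x => //; apply/pm_compP; exists y.
Qed.

Lemma am_comp_equivariant s z : pm_preimage p (pm_dom (isa_act s)) z ->
  exists x, pm_graph (pm_comp (isa_act s) p) z x /\
            pm_graph (pm_comp p (isa_act (h s))) z x.
Proof.
move=> /pm_preimageP[x /pm_compP[y zy yx] sx].
have ys : pm_preimage (am_map m) (pm_dom (isa_act s)) y by apply/pm_preimageP; exists x.
have [x' [/pm_compP[x2 yx2 xx'] /pm_compP[y' yy' yx']]] := am_equivariant ys.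
have zs : pm_preimage (am_map n) (pm_dom (isa_act (am_hom m s))) z.
  by apply/pm_preimageP; exists y => //; exact: pm_graph_dom yy'.
have [y3 [/pm_compP[y2 zy2 yy3] /pm_compP[z' zz' zy3]]] := am_equivariant zs.
move: yy3 zy3; rewrite -(pm_graph_fun zy zy2) => /(pm_graph_fun yy') <- zy'.
exists x'; split; apply/pm_compP.
  by exists x2 => //; apply/pm_compP; exists y.
by exists z' => //; apply/pm_compP; exists y'.
Qed.

Definition am_comp : action_morphism A C :=
  ActionMorphism am_comp_homM am_comp_dom am_comp_equivariant.

End ActionMorphismComp.

Lemma pm_compA (X Y Z W : topologicalType) (h : partial_map Z W) (g : partial_map Y Z) (f : partial_map X Y) :
  pm_comp h (pm_comp g f) = pm_comp (pm_comp h g) f.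
Proof.
apply: partial_map_eq => x w; split.
  move=> /pm_compP[z /pm_compP[y xy yz] zw]; apply/pm_compP; exists y => //.
  by apply/pm_compP; exists z.
move=> /pm_compP[y xy /pm_compP[z yz zw]]; apply/pm_compP; exists z => //.
by apply/pm_compP; exists y.
Qed.

Lemma pm_comp_pidl (X Y : topologicalType) (f : partial_map X Y) : pm_comp (pm_id Y) f = f.
Proof.
apply: partial_map_eq => x y; split; first by move=> /pm_compP[z xz /pm_idP <-].
by move=> xy; apply/pm_compP; exists y => //; apply/pm_idP.
Qed.

Lemma pm_comp_pidr (X Y : topologicalType) (f : partial_map X Y) : pm_comp f (pm_id X) = f.
Proof.
apply: partial_map_eq => x y; split; first by move=> /pm_compP[z /pm_idP ->].
by move=> xy; apply/pm_compP; exists x => //; apply/pm_idP.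
Qed.

Lemma am_compA (A B C D : isaction) (h : action_morphism C D)
    (g : action_morphism B C) (f : action_morphism A B) :
  am_comp h (am_comp g f) = am_comp (am_comp h g) f.
Proof. by apply: action_morphism_eq => //=; rewrite pm_compA. Qed.

Lemma am_comp1m (A B : isaction) (f : action_morphism A B) :
  am_comp (am_id B) f = f.
Proof. by apply: action_morphism_eq => //=; rewrite pm_comp_pidr. Qed.

Lemma am_compm1 (A B : isaction) (f : action_morphism A B) :
  am_comp f (am_id A) = f.
Proof. by apply: action_morphism_eq => //=; rewrite pm_comp_pidl. Qed.

Definition ISA : category :=
  @Category isaction action_morphism am_id
    (fun A B C n m => am_comp n m) am_compA am_comp1m am_compm1.

(** A groupoid with set of arrows [T].  The product [gmul e] of [g'] and [g] is
    only defined for composable arrows, witnessed by [e : gdom g' = grng g]. *)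
Record groupoid (T : Type) := Groupoid {
  units : set T;
  gdom : T -> units;
  grng : T -> units;
  gmul : forall g' g : T, gdom g' = grng g -> T;
  ginv : T -> T;
  gdom_unit : forall u : units, gdom (\val u) = u;
  grng_unit : forall u : units, grng (\val u) = u;
  gdom_mul : forall g' g (e : gdom g' = grng g), gdom (gmul e) = gdom g;
  grng_mul : forall g' g (e : gdom g' = grng g), grng (gmul e) = grng g';
  gmulA : forall g3 g2 g1 (e21 : gdom g2 = grng g1) (e32 : gdom g3 = grng g2)
      (e : gdom g3 = grng (gmul e21)) (e' : gdom (gmul e32) = grng g1),
    gmul e = gmul e';
  gmul_dom : forall g (e : gdom g = grng (\val (gdom g))), gmul e = g;
  gmul_rng : forall g (e : gdom (\val (grng g)) = grng g), gmul e = g;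
  gdom_inv : forall g, gdom (ginv g) = grng g;
  grng_inv : forall g, grng (ginv g) = gdom g;
  gmulV : forall g (e : gdom g = grng (ginv g)), gmul e = \val (grng g);
  gmulVl : forall g (e : gdom (ginv g) = grng g), gmul e = \val (gdom g)
}.
Arguments units {T} _.
Arguments gdom {T} _ _.
Arguments grng {T} _ _.
Arguments gmul {T} _ {g' g} e.
Arguments ginv {T} _ _.

(** The product of [g'] and [g] is defined and equal to [w]. *)
Definition gprod (T : Type) (G : groupoid T) (g' g w : T) : Prop :=
  exists e : gdom G g' = grng G g, gmul G e = w.

Definition composable (T : Type) (G : groupoid T) : set (T * T) :=
  [set p | gdom G p.1 = grng G p.2].

Definition gmul_pair (T : Type) (G : groupoid T) (p : composable G) : T :=
  gmul G (set_mem (valP p) : gdom G (\val p).1 = grng G (\val p).2).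

Record etale_groupoid := EtaleGroupoid {
  arrows :> topologicalType;
  gpd :> groupoid arrows;
  gmul_continuous : continuous (@gmul_pair _ gpd);
  ginv_continuous : continuous (ginv gpd);
  gdom_etale : local_homeomorphism (gdom gpd)
}.
Arguments ginv_continuous : clear implicits.

Section GroupoidFacts.
Context {T : Type} {G : groupoid T}.
Implicit Types g h : T.

Lemma gmul_irr g' g (e e' : gdom G g' = grng G g) : gmul G e = gmul G e'.
Proof. by rewrite (Prop_irrelevance e e'). Qed.

Lemma gprod_fun g' g w w' : gprod G g' g w -> gprod G g' g w' -> w = w'.
Proof. by move=> [e <-] [e' <-]; rewrite (Prop_irrelevance e e'). Qed.

Lemma gprod_ex g' g : gdom G g' = grng G g -> exists w, gprod G g' g w.
Proof. by move=> e; exists (gmul G e), e. Qed.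

Lemma gprod_dom g' g w : gprod G g' g w -> gdom G w = gdom G g.
Proof. by case=> e <-; exact: gdom_mul. Qed.

Lemma gprod_rng g' g w : gprod G g' g w -> grng G w = grng G g'.
Proof. by case=> e <-; exact: grng_mul. Qed.

Lemma gprod_comp g' g w : gprod G g' g w -> gdom G g' = grng G g.
Proof. by case. Qed.

Lemma gprodA g3 g2 g1 x y : gprod G g3 g2 x -> gprod G g2 g1 y ->
  forall w, gprod G x g1 w <-> gprod G g3 y w.
Proof.
move=> [e32 <-] [e21 <-] w; split=> -[e <-].
  have e' : gdom G g3 = grng G (gmul G e21) by rewrite grng_mul.
  by exists e'; exact: gmulA.
have e' : gdom G (gmul G e32) = grng G g1 by rewrite gdom_mul.
by exists e'; rewrite -(gmulA e e').
Qed.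

Lemma gprod_domr g : gprod G g (\val (gdom G g)) g.
Proof.
have e : gdom G g = grng G (\val (gdom G g)) by rewrite grng_unit.
by exists e; exact: gmul_dom.
Qed.

Lemma gprod_rngl g : gprod G (\val (grng G g)) g g.
Proof.
have e : gdom G (\val (grng G g)) = grng G g by rewrite gdom_unit.
by exists e; exact: gmul_rng.
Qed.

Lemma gprod_inv g : gprod G g (ginv G g) (\val (grng G g)).
Proof.
have e : gdom G g = grng G (ginv G g) by rewrite grng_inv.
by exists e; exact: gmulV.
Qed.

Lemma gprod_invl g : gprod G (ginv G g) g (\val (gdom G g)).
Proof.
have e : gdom G (ginv G g) = grng G g by rewrite gdom_inv.
by exists e; exact: gmulVl.
Qed.

Lemma gprod_invr g' g w : gprod G g' g w -> gprod G w (ginv G g) g'.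
Proof.
move=> h; apply/(gprodA h (gprod_inv g)).
rewrite -(gprod_comp h); exact: gprod_domr.
Qed.

Lemma gprod_invll g' g w : gprod G g' g w -> gprod G (ginv G g') w g.
Proof.
move=> h; apply/(gprodA (gprod_invl g') h).
rewrite (gprod_comp h); exact: gprod_rngl.
Qed.

Lemma gprod_cancell g' g1 g2 w : gprod G g' g1 w -> gprod G g' g2 w -> g1 = g2.
Proof. move=> /gprod_invll h /gprod_invll; exact: gprod_fun. Qed.

Lemma gprod_cancelr g' g1 g2 w : gprod G g1 g' w -> gprod G g2 g' w -> g1 = g2.
Proof. move=> /gprod_invr h /gprod_invr; exact: gprod_fun. Qed.

Lemma ginvK g : ginv G (ginv G g) = g.
Proof.
apply: (@gprod_cancell (ginv G g) _ _ (\val (gdom G g))).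
  by rewrite -grng_inv; exact: gprod_inv.
exact: gprod_invl.
Qed.

Lemma gprod_unit g : gprod G g g g -> units G g.
Proof.
move=> h; have -> : g = \val (gdom G g).
  by apply: (gprod_cancell h); exact: gprod_domr.
exact: val_in.
Qed.

Lemma unit_val g : units G g -> \val (gdom G g) = g.
Proof.
move=> /mem_set h.
by have := gdom_unit (exist _ g h : units G) => /= ->.
Qed.

Lemma unit_valr g : units G g -> \val (grng G g) = g.
Proof.
move=> /mem_set h.
by have := grng_unit (exist _ g h : units G) => /= ->.
Qed.

End GroupoidFacts.

Section EtaleFacts.
Context {G : etale_groupoid}.

Lemma gdom_continuous : continuous (gdom G).
Proof. by have /local_homeomorphismP[] := @gdom_etale G. Qed.

Lemma gdom_open : open_map (gdom G).
Proof. by have /local_homeomorphismP[] := @gdom_etale G. Qed.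

Lemma gdom_local_inj (x : G) : exists U : set G,
  [/\ open U, U x & forall y z, U y -> U z -> gdom G y = gdom G z -> y = z].
Proof. by have /local_homeomorphismP[_ _] := @gdom_etale G; exact. Qed.

Lemma ginv_open : open_map (ginv G).
Proof.
move=> U oU; have /continuousP/(_ U oU) := ginv_continuous G; congr open.
apply/seteqP; split=> [x Ux|_ [x Ux <-]]; last by rewrite /= ginvK.
by exists (ginv G x); rewrite ?ginvK.
Qed.

Lemma grng_continuous : continuous (grng G).
Proof.
rewrite (_ : grng G = gdom G \o ginv G); last first.
  by apply/funext => g /=; rewrite gdom_inv.
exact: comp_continuous (@ginv_continuous G) gdom_continuous.
Qed.

Lemma units_open : open (units G).
Proof.
apply: open_local => u Gu; have [U [oU Uu Ui]] := gdom_local_inj u.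
exists (U `&` [set g | U (\val (gdom G g))]); split.
- apply: openI => //.
  have cd := comp_continuous gdom_continuous (@val_continuous _ (units G)).
  by have /continuousP/(_ U oU) := cd.
- by split=> //=; rewrite unit_val.
- move=> g [Ug Udg]; rewrite (Ui _ _ Ug Udg) ?gdom_unit //; exact: val_in.
Qed.

Lemma gprod_nbhs (g' g w : G) (W : set G) : gprod G g' g w -> open W -> W w ->
  exists A B : set G, [/\ open A, open B, A g', B g &
    forall a b c, A a -> B b -> gprod G a b c -> W c].
Proof.
move=> [e <-] oW Ww.
pose p : composable G := exist _ (g', g) (mem_set e).
have /continuous_nbhsP/(_ p W oW) := @gmul_continuous G.
case.
  by rewrite /gmul_pair (gmul_irr _ e).
move=> _ [[O oO <-] Op OW].
have [A [B [oA oB Ag' Bg AB]]] := open_prodP oO Op.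
exists A, B; split=> // a b c Aa Bb [e' <-].
have := OW (exist _ (a, b) (mem_set e')) (AB _ _ Aa Bb).
by rewrite /= /gmul_pair (gmul_irr _ e').
Qed.

End EtaleFacts.

Record bis (G : etale_groupoid) := Bis {
  bis_set :> set G;
  bis_open : open bis_set;
  bis_dom_inj : set_inj bis_set (gdom G);
  bis_rng_inj : set_inj bis_set (grng G)
}.

Lemma set_injP (X Y : Type) (A : set X) (f : X -> Y) :
  set_inj A f <-> forall x y, A x -> A y -> f x = f y -> x = y.
Proof.
split=> [h x y /mem_set Ax /mem_set Ay|h x y /set_mem Ax /set_mem Ay]; exact: h.
Qed.

Section Bisections.
Context {G : etale_groupoid}.
Implicit Types U V W : bis G.

Lemma bis_eq U V : (bis_set U = bis_set V) -> U = V.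
Proof.
case: U V => [U a b c] [V a' b' c'] /= e; subst V.
by rewrite (Prop_irrelevance a a') (Prop_irrelevance b b') (Prop_irrelevance c c').
Qed.

Lemma bis_domI U g h : bis_set U g -> bis_set U h -> gdom G g = gdom G h -> g = h.
Proof. by have /set_injP := @bis_dom_inj _ U; exact. Qed.

Lemma bis_rngI U g h : bis_set U g -> bis_set U h -> grng G g = grng G h -> g = h.
Proof. by have /set_injP := @bis_rng_inj _ U; exact. Qed.

Definition bis_mul_set U V : set G :=
  [set w | exists u v, [/\ bis_set U u, bis_set V v & gprod G u v w]].

Lemma bis_mul_open U V : open (bis_mul_set U V).
Proof.
apply: open_local => w0 [u0 [v0 [Uu0 Vv0 p0]]].
have [A [B [oA oB Aw0 Bv0 AB]]] := gprod_nbhs (gprod_invr p0) (@bis_open _ U) Uu0.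
pose V1 : set G := bis_set V `&` (fun v => B (ginv G v)).
have oV1 : open V1.
  by apply: openI; [exact: bis_open|have /continuousP/(_ B oB) := ginv_continuous G].
exists (A `&` (gdom G @^-1` (gdom G @` V1))); split.
- apply: openI => //; have /continuousP := @gdom_continuous G; apply; exact: gdom_open.
- by split=> //; exists v0 => //; rewrite (gprod_dom p0).
- move=> w [Aw [v [Vv Bv] e]].
  have [u wu] : exists u, gprod G w (ginv G v) u by apply: gprod_ex; rewrite grng_inv.
  exists u, v; split=> //; first exact: AB wu.
  by have := gprod_invr wu; rewrite ginvK.
Qed.

Lemma bis_mul_dom_inj U V : set_inj (bis_mul_set U V) (gdom G).
Proof.
apply/set_injP => w w' [u [v [Uu Vv p]]] [u' [v' [Uu' Vv' p']]].
rewrite (gprod_dom p) (gprod_dom p') => /(bis_domI Vv Vv') vv; subst v'.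
have uu : u = u' by apply: (bis_domI Uu Uu'); rewrite (gprod_comp p) (gprod_comp p').
by subst u'; exact: gprod_fun p p'.
Qed.

Lemma bis_mul_rng_inj U V : set_inj (bis_mul_set U V) (grng G).
Proof.
apply/set_injP => w w' [u [v [Uu Vv p]]] [u' [v' [Uu' Vv' p']]].
rewrite (gprod_rng p) (gprod_rng p') => /(bis_rngI Uu Uu') uu; subst u'.
have vv : v = v' by apply: (bis_rngI Vv Vv'); rewrite -(gprod_comp p) -(gprod_comp p').
by subst v'; exact: gprod_fun p p'.
Qed.

Definition bis_mul U V : bis G :=
  Bis (@bis_mul_open U V) (@bis_mul_dom_inj U V) (@bis_mul_rng_inj U V).

Lemma bis_mulA : associative bis_mul.
Proof.
move=> U V W; apply: bis_eq; apply/seteqP; split=> x.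
  move=> [u [y [Uu [v [w [Vv Ww p]]] q]]].
  have [z r] : exists z, gprod G u v z.
    by apply: gprod_ex; rewrite (gprod_comp q) (gprod_rng p).
  exists z, w; split=> //; first by exists u, v.
  exact/(gprodA r p).
move=> [y [w [[u [v [Uu Vv p]]] Ww q]]].
have [z r] : exists z, gprod G v w z.
  by apply: gprod_ex; rewrite -(gprod_comp q) (gprod_dom p).
exists u, z; split=> //; first by exists v, w.
exact/(gprodA p r).
Qed.

HB.instance Definition _ := gen_eqMixin (bis G).
HB.instance Definition _ := gen_choiceMixin (bis G).
HB.instance Definition _ := isSemigroup.Build (bis G) bis_mulA.

Lemma bis_mulE U V : bis_set (U * V)%g = bis_mul_set U V.
Proof. by []. Qed.

Lemma bis_inv_dom_inj U : set_inj (ginv G @` bis_set U) (gdom G).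
Proof.
apply/set_injP => _ _ [g Ug <-] [h Uh <-]; rewrite !gdom_inv.
by move=> /(bis_rngI Ug Uh) ->.
Qed.

Lemma bis_inv_rng_inj U : set_inj (ginv G @` bis_set U) (grng G).
Proof.
apply/set_injP => _ _ [g Ug <-] [h Uh <-]; rewrite !grng_inv.
by move=> /(bis_domI Ug Uh) ->.
Qed.

Definition bis_inv U : bis G :=
  Bis (ginv_open (@bis_open _ U)) (@bis_inv_dom_inj U) (@bis_inv_rng_inj U).

Lemma bis_mul3 U V g : (U * V * U)%g = U -> bis_set U g -> bis_set V (ginv G g).
Proof.
move=> UVU Ug; move: (Ug); rewrite -{1}UVU.
move=> [x [u2 [[u1 [v [Uu1 Vv p]]] Uu2 q]]].
have e2 : u2 = g by apply: (bis_domI Uu2 Ug); rewrite (gprod_dom q).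
have e1 : u1 = g by apply: (bis_rngI Uu1 Ug); rewrite (gprod_rng q) (gprod_rng p).
subst u1 u2.
have gx : x = \val (grng G g) by apply: (gprod_cancelr q); exact: gprod_rngl.
rewrite gx in p; by rewrite (gprod_cancell (gprod_inv g) p).
Qed.

Lemma bis_inverse_unique U :
  exists! V : bis G, (U * V * U)%g = U /\ (V * U * V)%g = V.
Proof.
have tri (U1 : bis G) : (U1 * bis_inv U1 * U1)%g = U1.
  apply: bis_eq; apply/seteqP; split=> g.
    move=> [x [u2 [[u1 [_ [Uu1 [v Vv <-] p]]] Uu2 q]]].
    have e1 : u1 = v.
      by apply: (bis_domI Uu1 Vv); rewrite (gprod_comp p) grng_inv.
    subst u1; have ex := gprod_fun p (gprod_inv v); subst x.
    have := gprod_comp q; rewrite gdom_unit => /(bis_rngI Vv Uu2) e; subst u2.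
    by rewrite (gprod_fun q (gprod_rngl v)).
  move=> Ug; exists (\val (grng G g)), g; split=> //; last exact: gprod_rngl.
  by exists g, (ginv G g); split=> //; [exists g|exact: gprod_inv].
have invK (U1 : bis G) : bis_inv (bis_inv U1) = U1.
  apply: bis_eq; apply/seteqP; split=> g.
    by move=> [_ [h Uh <-] <-]; rewrite ginvK.
  by move=> Ug; exists (ginv G g); [exists g|rewrite ginvK].
exists (bis_inv U); split.
  by split; [exact: tri|have := tri (bis_inv U); rewrite invK].
move=> V [UVU VUV]; apply: bis_eq; apply/seteqP; split.
  by move=> _ [g Ug <-]; exact: bis_mul3 UVU Ug.
move=> v Vv; exists (ginv G v); last exact: ginvK.
exact: bis_mul3 VUV Vv.
Qed.

HB.instance Definition _ :=
  Semigroup_isInverse.Build (bis G) bis_inverse_unique.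

(** [gamma_U = r|_U o (d|_U)^-1]. *)

Definition bis_dom U : partial_map G (units G) :=
  pm_restrict (@gdom_continuous G) (@bis_open _ U).

Definition bis_rng U : partial_map G (units G) :=
  pm_restrict (@grng_continuous G) (@bis_open _ U).

Lemma bis_dom_fun_inj U : injective (pm_fun (bis_dom U)).
Proof.
by move=> x y e; apply: set_type_inj; apply: (bis_domI (val_in x) (val_in y)).
Qed.

Lemma bis_dom_fun_open U : open_map (pm_fun (bis_dom U)).
Proof. exact: open_mapS (@gdom_open G) (@bis_open _ U). Qed.

Definition slice_partial_map U : partial_map (units G) (units G) :=
  pm_comp (bis_rng U) (pm_inv (@bis_dom_fun_inj U) (@bis_dom_fun_open U)).

Lemma slice_partial_mapP U u v : pm_graph (slice_partial_map U) u v <->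
  exists g, [/\ bis_set U g, gdom G g = u & grng G g = v].
Proof.
split=> [/pm_compP[g /pm_invP/pm_restrictP[Ug gu] /pm_restrictP[_ gv]]|[g [Ug gu gv]]].
  by exists g.
by apply/pm_compP; exists g; [apply/pm_invP|]; apply/pm_restrictP.
Qed.

Lemma slice_subproof U : open_embedding (pm_fun (slice_partial_map U)).
Proof.
apply: open_embedding_graph.
  move=> u u' v /slice_partial_mapP[g [Ug <- gv]] /slice_partial_mapP[h [Uh <- hv]].
  by rewrite (bis_rngI Ug Uh) // gv.
move=> O oO; have := pm_preimage_open (slice_partial_map (bis_inv U)) oO; congr open.
apply/seteqP; split=> v.
  move=> /pm_preimageP[u /slice_partial_mapP[_ [[g Ug <-] <- <-]]].
  rewrite grng_inv => Og; exists (gdom G g) => //.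
  by apply/slice_partial_mapP; exists g; rewrite gdom_inv.
move=> [u Ou /slice_partial_mapP[g [Ug gu gv]]]; apply/pm_preimageP; exists u => //.
apply/slice_partial_mapP; exists (ginv G g); rewrite gdom_inv grng_inv; split=> //.
by exists g.
Qed.

Definition slice_map U : phomeo (units G) := PHomeo (slice_subproof U).

Lemma slice_mapM : {morph slice_map : U V / (U * V)%g}.
Proof.
move=> U V; apply: phomeo_eq => a c; split.
  move=> /slice_partial_mapP[w [[u [v [Uu Vv p]]] wa wc]]; apply/phomeo_mulP.
  exists (grng G v); apply/slice_partial_mapP.
    by exists v; rewrite -(gprod_dom p).
  by exists u; rewrite -(gprod_rng p) (gprod_comp p).
move=> /phomeo_mulP[b /slice_partial_mapP[v [Vv va vb]] /slice_partial_mapP[u [Uu ub uc]]].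
have [w p] : exists w, gprod G u v w by apply: gprod_ex; rewrite ub.
apply/slice_partial_mapP; exists w; rewrite (gprod_dom p) (gprod_rng p); split=> //.
by exists u, v.
Qed.

Lemma bis_units_dom_inj : set_inj (units G) (gdom G).
Proof.
apply/set_injP => g h Gg Gh e.
by rewrite -(unit_val Gg) -(unit_val Gh) e.
Qed.

Lemma bis_units_rng_inj : set_inj (units G) (grng G).
Proof.
apply/set_injP => g h Gg Gh.
by rewrite -(unit_val Gg) -(unit_val Gh) !grng_unit => ->.
Qed.

Definition bis_units : bis G :=
  Bis (@units_open G) bis_units_dom_inj bis_units_rng_inj.

Lemma slice_cover : \bigcup_U pm_dom (slice_map U) = setT.
Proof.
apply/seteqP; split=> // u _; exists bis_units => //.
have h : pm_graph (slice_map bis_units) u u.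
  apply/slice_partial_mapP; exists (\val u); rewrite gdom_unit grng_unit; split=> //.
  exact: val_in.
exact: pm_graph_dom h.
Qed.

End Bisections.

Definition slice_action (G : etale_groupoid) : isaction :=
  ISAction (@slice_mapM G) (@slice_cover G).

Record chom (G H : etale_groupoid) := CHom {
  chom_fun :> G -> H;
  chom_continuous : continuous chom_fun;
  chom_mul : forall g' g w, gprod G g' g w ->
    gprod H (chom_fun g') (chom_fun g) (chom_fun w)
}.
Arguments chom_continuous {G H} _.

Section HomFacts.
Context {G H : etale_groupoid} (f : chom G H).

Lemma chom_units g : units G g -> units H (f g).
Proof.
move=> Gg; apply: gprod_unit; apply: chom_mul.
by have := gprod_domr (G := G) g; rewrite (unit_val Gg).
Qed.

Definition chom0 (u : units G) : units H :=
  exist _ (f (\val u)) (mem_set (chom_units (val_in u))).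

Lemma chom0_continuous : continuous chom0.
Proof.
apply/continuous_subP.
exact: (comp_continuous (@val_continuous _ (units G)) (chom_continuous f)).
Qed.

Lemma chom_dom g : gdom H (f g) = chom0 (gdom G g).
Proof.
rewrite (gprod_comp (chom_mul f (gprod_domr (G := G) g))).
by rewrite -[RHS](grng_unit (chom0 _)).
Qed.

Lemma chom_rng g : grng H (f g) = chom0 (grng G g).
Proof.
rewrite -(gprod_comp (chom_mul f (gprod_rngl (G := G) g))).
by rewrite -[RHS](gdom_unit (chom0 _)).
Qed.

Lemma chom_inv g : f (ginv G g) = ginv H (f g).
Proof.
have h := chom_mul f (gprod_inv (G := G) g).
have := gprod_inv (G := H) (f g); rewrite chom_rng => h'.
exact: gprod_cancell h h'.
Qed.

End HomFacts.
Arguments chom0_continuous {G H} f.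

Definition chom_id (G : etale_groupoid) : chom G G :=
  @CHom G G id (@id_continuous G) (fun _ _ _ => id).

Definition chom_comp (G1 G2 G3 : etale_groupoid) (g : chom G2 G3) (f : chom G1 G2) :
    chom G1 G3 :=
  @CHom G1 G3 (fun x => g (f x))
    (comp_continuous (chom_continuous f) (chom_continuous g))
    (fun _ _ _ h => chom_mul g (chom_mul f h)).

Definition fibre (G : etale_groupoid) (u : units G) : set G :=
  [set g | gdom G g = u].

Definition fibrewise_bijective (G H : etale_groupoid) (f : chom G H) : Prop :=
  forall u : units G, set_bij (fibre u) (fibre (chom0 f u)) f.

Record couple (G H : etale_groupoid) := Couple {
  couple_gpd : etale_groupoid;
  couple_phi : chom couple_gpd G;
  couple_psi : chom couple_gpd H;
  couple_phi_bij : fibrewise_bijective couple_phi;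
  couple_psi_open : open_map (chom0 couple_psi);
  couple_psi_inj : injective (chom0 couple_psi)
}.
Arguments couple_phi {G H} c.
Arguments couple_psi {G H} c.
Arguments couple_phi_bij {G H} c.
Arguments couple_psi_open {G H} c.
Arguments couple_psi_inj {G H} c.

(** A homeomorphic isomorphism is given by two mutually inverse continuous
    homomorphisms. *)
Definition couple_equiv (G H : etale_groupoid) (c1 c2 : couple G H) : Prop :=
  exists (i : chom (couple_gpd c1) (couple_gpd c2))
         (j : chom (couple_gpd c2) (couple_gpd c1)),
    [/\ cancel i j, cancel j i,
        forall k, couple_phi c2 (i k) = couple_phi c1 k &
        forall k, couple_psi c2 (i k) = couple_psi c1 k].

Section CoupleEquiv.
Context {G H : etale_groupoid}.
Implicit Types c : couple G H.

Lemma couple_equiv_refl c : couple_equiv c c.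
Proof. by exists (chom_id _), (chom_id _). Qed.

Lemma couple_equiv_sym c1 c2 : couple_equiv c1 c2 -> couple_equiv c2 c1.
Proof.
move=> [i [j [ij ji e e']]]; exists j, i; split=> // k.
  by rewrite -e ji.
by rewrite -e' ji.
Qed.

Lemma couple_equiv_trans c1 c2 c3 :
  couple_equiv c1 c2 -> couple_equiv c2 c3 -> couple_equiv c1 c3.
Proof.
move=> [i [j [ij ji e e']]] [k [l [kl lk d d']]].
exists (chom_comp k i), (chom_comp j l); split=> x /=.
- by rewrite kl ij.
- by rewrite ji lk.
- by rewrite d e.
- by rewrite d' e'.
Qed.

End CoupleEquiv.

Section FibreProduct.
Context {K1 K2 G : etale_groupoid} (f1 : chom K1 G) (f2 : chom K2 G).

Definition fibprod_set : set (K1 * K2) := [set k | f1 k.1 = f2 k.2].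

Local Notation P := (set_type fibprod_set).

Definition fpair (k1 : K1) (k2 : K2) (e : f1 k1 = f2 k2) : P :=
  exist _ (k1, k2) (mem_set (e : fibprod_set (k1, k2))).

Definition fibprod1 (k : P) : K1 := (\val k).1.
Definition fibprod2 (k : P) : K2 := (\val k).2.

Lemma fibprodE (k : P) : f1 (fibprod1 k) = f2 (fibprod2 k).
Proof. exact: (val_in k). Qed.

Lemma fibprod_eq (k l : P) : fibprod1 k = fibprod1 l -> fibprod2 k = fibprod2 l -> k = l.
Proof.
rewrite /fibprod1 /fibprod2 => e1 e2; apply: set_type_inj.
by case: (\val k) (\val l) e1 e2 => [? ?] [? ?] /= -> ->.
Qed.

Definition fibprod_units : set P :=
  [set k | units K1 (fibprod1 k) /\ units K2 (fibprod2 k)].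

Lemma fibprod_dom_subproof (k : P) :
  f1 (\val (gdom K1 (fibprod1 k))) = f2 (\val (gdom K2 (fibprod2 k))).
Proof.
have := congr1 (fun g => \val (gdom G g)) (fibprodE k).
by rewrite /= !chom_dom.
Qed.

Lemma fibprod_rng_subproof (k : P) :
  f1 (\val (grng K1 (fibprod1 k))) = f2 (\val (grng K2 (fibprod2 k))).
Proof.
have := congr1 (fun g => \val (grng G g)) (fibprodE k).
by rewrite /= !chom_rng.
Qed.

Definition fibprod_dom (k : P) : fibprod_units :=
  exist _ (fpair (fibprod_dom_subproof k))
    (mem_set (conj (val_in _) (val_in _) : fibprod_units (fpair _))).

Definition fibprod_rng (k : P) : fibprod_units :=
  exist _ (fpair (fibprod_rng_subproof k))
    (mem_set (conj (val_in _) (val_in _) : fibprod_units (fpair _))).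

Lemma fibprod_comp1 (k' k : P) : fibprod_dom k' = fibprod_rng k ->
  gdom K1 (fibprod1 k') = grng K1 (fibprod1 k).
Proof. by move=> [e _]; apply: set_type_inj. Qed.

Lemma fibprod_comp2 (k' k : P) : fibprod_dom k' = fibprod_rng k ->
  gdom K2 (fibprod2 k') = grng K2 (fibprod2 k).
Proof. by move=> [_ e]; apply: set_type_inj. Qed.

Lemma fibprod_mul_subproof (k' k : P) (e : fibprod_dom k' = fibprod_rng k) :
  f1 (gmul K1 (fibprod_comp1 e)) = f2 (gmul K2 (fibprod_comp2 e)).
Proof.
have h1 : gprod K1 (fibprod1 k') (fibprod1 k) (gmul K1 (fibprod_comp1 e)) by eexists.
have h2 : gprod K2 (fibprod2 k') (fibprod2 k) (gmul K2 (fibprod_comp2 e)) by eexists.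
have := chom_mul f1 h1; rewrite !fibprodE => h.
exact: gprod_fun h (chom_mul f2 h2).
Qed.

Definition fibprod_mul (k' k : P) (e : fibprod_dom k' = fibprod_rng k) : P :=
  fpair (fibprod_mul_subproof e).

Lemma fibprod_inv_subproof (k : P) :
  f1 (ginv K1 (fibprod1 k)) = f2 (ginv K2 (fibprod2 k)).
Proof. by rewrite !chom_inv fibprodE. Qed.

Definition fibprod_inv (k : P) : P := fpair (fibprod_inv_subproof k).

Definition fibprod_groupoid : groupoid P.
Proof.
apply: (@Groupoid P fibprod_units fibprod_dom fibprod_rng fibprod_mul fibprod_inv).
- move=> u; have [u1 u2] := val_in u.
  by apply: set_type_inj; apply: fibprod_eq; exact: unit_val.
- move=> u; have [u1 u2] := val_in u.
  by apply: set_type_inj; apply: fibprod_eq; exact: unit_valr.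
- move=> g' g e; apply: set_type_inj; apply: fibprod_eq;
    by rewrite /fibprod1 /fibprod2 /= gdom_mul.
- move=> g' g e; apply: set_type_inj; apply: fibprod_eq;
    by rewrite /fibprod1 /fibprod2 /= grng_mul.
- move=> g3 g2 g1 e21 e32 e e'; apply: fibprod_eq;
    rewrite /fibprod1 /fibprod2 /=; exact: gmulA.
- move=> g e; apply: fibprod_eq; rewrite /fibprod1 /fibprod2 /=; exact: gmul_dom.
- move=> g e; apply: fibprod_eq; rewrite /fibprod1 /fibprod2 /=; exact: gmul_rng.
- move=> g; apply: set_type_inj; apply: fibprod_eq;
    by rewrite /fibprod1 /fibprod2 /= gdom_inv.
- move=> g; apply: set_type_inj; apply: fibprod_eq;
    by rewrite /fibprod1 /fibprod2 /= grng_inv.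
- move=> g e; apply: fibprod_eq; rewrite /fibprod1 /fibprod2 /=; exact: gmulV.
- move=> g e; apply: fibprod_eq; rewrite /fibprod1 /fibprod2 /=; exact: gmulVl.
Defined.

Lemma fibprod1_continuous : continuous (fibprod1 : fibprod_set -> K1).
Proof. exact: (comp_continuous (@val_continuous _ fibprod_set) fst_continuous). Qed.

Lemma fibprod2_continuous : continuous (fibprod2 : fibprod_set -> K2).
Proof. exact: (comp_continuous (@val_continuous _ fibprod_set) snd_continuous). Qed.

Lemma continuous_fprodP (L : topologicalType) (h : L -> fibprod_set) :
  continuous (fun x => fibprod1 (h x)) -> continuous (fun x => fibprod2 (h x)) ->
  continuous h.
Proof.
move=> c1 c2; apply/continuous_subP.
suff -> : (fun x => \val (h x)) = (fun x => (fibprod1 (h x), fibprod2 (h x))).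
  exact: pair_continuous.
by apply/funext => x; case: (h x) => -[].
Qed.

Lemma fibprod_mul_continuous : continuous (@gmul_pair _ fibprod_groupoid).
Proof.
have cv := @val_continuous _ (composable fibprod_groupoid).
apply: continuous_fprodP.
  pose m (p : composable fibprod_groupoid) : composable K1 :=
    exist _ (fibprod1 (\val p).1, fibprod1 (\val p).2)
      (mem_set (fibprod_comp1 (val_in p) : composable K1 (_, _))).
  have cm : continuous m.
    apply/continuous_subP; apply: pair_continuous;
      apply: comp_continuous fibprod1_continuous.
      exact: comp_continuous cv fst_continuous.
    exact: comp_continuous cv snd_continuous.
  rewrite (_ : (fun p => _) = @gmul_pair _ K1 \o m).
    exact: comp_continuous cm (@gmul_continuous K1).
  by apply/funext => p; exact: gmul_irr.
pose m (p : composable fibprod_groupoid) : composable K2 :=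
  exist _ (fibprod2 (\val p).1, fibprod2 (\val p).2)
    (mem_set (fibprod_comp2 (val_in p) : composable K2 (_, _))).
have cm : continuous m.
  apply/continuous_subP; apply: pair_continuous;
    apply: comp_continuous fibprod2_continuous.
    exact: comp_continuous cv fst_continuous.
  exact: comp_continuous cv snd_continuous.
rewrite (_ : (fun p => _) = @gmul_pair _ K2 \o m).
  exact: comp_continuous cm (@gmul_continuous K2).
by apply/funext => p; exact: gmul_irr.
Qed.

Lemma fibprod_inv_continuous : continuous (ginv fibprod_groupoid).
Proof.
apply: continuous_fprodP.
  exact: comp_continuous fibprod1_continuous (ginv_continuous K1).
exact: comp_continuous fibprod2_continuous (ginv_continuous K2).
Qed.

Lemma fibprod_box_open (A : set K1) (B : set K2) : open A -> open B ->
  open [set k : fibprod_set | A (fibprod1 k) /\ B (fibprod2 k)].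
Proof.
move=> oA oB; apply: openI.
  by have /continuousP/(_ A oA) := fibprod1_continuous.
by have /continuousP/(_ B oB) := fibprod2_continuous.
Qed.

Lemma fibprod_dom_open : open_map (gdom fibprod_groupoid).
Proof.
move=> W [O oO <-]; apply: open_local => _ [k Ok <-].
have [A [B [oA oB Ak Bk AB]]] := open_prodP oO Ok.
have [N [oN Nk Ni]] := gdom_local_inj (f1 (fibprod1 k)).
pose A' : set K1 := A `&` f1 @^-1` N; pose B' : set K2 := B `&` f2 @^-1` N.
have oA' : open A'.
  by apply: openI => //; have /continuousP/(_ N oN) := chom_continuous f1.
have oB' : open B'.
  by apply: openI => //; have /continuousP/(_ N oN) := chom_continuous f2.
exists [set u : fibprod_units | (gdom K1 @` A') (gdom K1 (fibprod1 (\val u))) /\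
                              (gdom K2 @` B') (gdom K2 (fibprod2 (\val u)))].
split.
- pose Q1 : set K1 := gdom K1 @^-1` (gdom K1 @` A').
  pose Q2 : set K2 := gdom K2 @^-1` (gdom K2 @` B').
  have oQ1 : open Q1.
    by have /continuousP := @gdom_continuous K1; apply; exact: gdom_open.
  have oQ2 : open Q2.
    by have /continuousP := @gdom_continuous K2; apply; exact: gdom_open.
  by exists [set k | Q1 (fibprod1 k) /\ Q2 (fibprod2 k)] => //; exact: fibprod_box_open.
- rewrite /= !gdom_unit; split.
    by exists (fibprod1 k).
  by exists (fibprod2 k) => //; split=> //=; rewrite -fibprodE.
- move=> u [[a [Aa Na] ea] [b [Bb Nb] eb]]; have [u1 u2] := val_in u.
  have e : f1 a = f2 b.
    apply: Ni => //; rewrite !chom_dom ea eb; apply: set_type_inj => /=.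
    by rewrite !unit_val // fibprodE.
  exists (fpair e); first exact: AB.
  apply: set_type_inj; apply: fibprod_eq; rewrite /fibprod1 /fibprod2 /=.
    by rewrite ea unit_val.
  by rewrite eb unit_val.
Qed.

Lemma fibprod_etale : local_homeomorphism (gdom fibprod_groupoid).
Proof.
apply/local_homeomorphismP; split.
- apply/continuous_subP; apply: continuous_fprodP.
    exact: (comp_continuous fibprod1_continuous
      (comp_continuous (@gdom_continuous K1) (@val_continuous _ (units K1)))).
  exact: (comp_continuous fibprod2_continuous
    (comp_continuous (@gdom_continuous K2) (@val_continuous _ (units K2)))).
- exact: fibprod_dom_open.
move=> k; have [A [oA Ak Ai]] := gdom_local_inj (fibprod1 k).
have [B [oB Bk Bi]] := gdom_local_inj (fibprod2 k).
exists [set l | A (fibprod1 l) /\ B (fibprod2 l)]; split=> //.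
  exact: fibprod_box_open.
move=> l m [Al Bl] [Am Bm] [e1 e2]; apply: fibprod_eq.
  by apply: Ai => //; exact: set_type_inj.
by apply: Bi => //; exact: set_type_inj.
Qed.

Definition fibprod : etale_groupoid :=
  EtaleGroupoid fibprod_mul_continuous fibprod_inv_continuous fibprod_etale.

Lemma fibprod_prodP (k' k w : fibprod) : gprod fibprod k' k w <->
  gprod K1 (fibprod1 k') (fibprod1 k) (fibprod1 w) /\
  gprod K2 (fibprod2 k') (fibprod2 k) (fibprod2 w).
Proof.
split=> [[e <-]|[h1 h2]]; first by split; eexists.
have e : fibprod_dom k' = fibprod_rng k.
  apply: set_type_inj; apply: fibprod_eq; rewrite /fibprod1 /fibprod2 /=.
    by rewrite (gprod_comp h1).
  by rewrite (gprod_comp h2).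
exists e; apply: fibprod_eq.
  by apply: (gprod_fun _ h1); eexists.
by apply: (gprod_fun _ h2); eexists.
Qed.

Definition fproj1 : chom fibprod K1 :=
  @CHom fibprod K1 fibprod1 fibprod1_continuous
    (fun k' k w h => proj1 ((iffLR (fibprod_prodP k' k w)) h)).

Definition fproj2 : chom fibprod K2 :=
  @CHom fibprod K2 fibprod2 fibprod2_continuous
    (fun k' k w h => proj2 ((iffLR (fibprod_prodP k' k w)) h)).

Section Universal.
Context {L : etale_groupoid} (h1 : chom L K1) (h2 : chom L K2).
Context (h12 : forall x, f1 (h1 x) = f2 (h2 x)).

Lemma flift_continuous : continuous ((fun x => fpair (h12 x)) : L -> fibprod).
Proof. by apply: continuous_fprodP; exact: chom_continuous. Qed.

Lemma flift_mul x' x w : gprod L x' x w ->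
  gprod fibprod (fpair (h12 x')) (fpair (h12 x)) (fpair (h12 w)).
Proof. by move=> h; apply/fibprod_prodP; split; exact: chom_mul. Qed.

Definition flift : chom L fibprod := CHom flift_continuous flift_mul.

End Universal.

End FibreProduct.

Section CoupleComp.
Context {G1 G2 G3 : etale_groupoid} (c2 : couple G2 G3) (c1 : couple G1 G2).

Let K := fibprod (couple_psi c1) (couple_phi c2).
Let phi : chom K G1 := chom_comp (couple_phi c1) (fproj1 _ _).
Let psi : chom K G3 := chom_comp (couple_psi c2) (fproj2 _ _).

Lemma fibrewiseP (G H : etale_groupoid) (f : chom G H) :
  fibrewise_bijective f <->
  (forall g h, gdom G g = gdom G h -> f g = f h -> g = h) /\
  (forall (u : units G) x, gdom H x = chom0 f u -> exists2 g, gdom G g = u & f g = x).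
Proof.
split=> [fb|[fi fs] u].
  split.
    move=> g h gh; have [_ /set_injP fi _] := fb (gdom G g).
    by apply: fi.
  by move=> u x xu; have [_ _ fs] := fb u; exact: fs.
split.
- by move=> g /= gu; rewrite /fibre /= chom_dom gu.
- by apply/set_injP => g h gu hu; apply: fi; rewrite gu hu.
- by move=> x xu; exact: fs.
Qed.

Lemma couple_comp_phi_bij : fibrewise_bijective phi.
Proof.
have /fibrewiseP[i1 s1] := couple_phi_bij c1.
have /fibrewiseP[i2 s2] := couple_phi_bij c2.
apply/fibrewiseP; split.
  move=> g h [e1 e2] /= e; have e' : fibprod1 g = fibprod1 h.
    by apply: i1 => //; exact: set_type_inj.
  apply: fibprod_eq => //; apply: i2; first exact: set_type_inj.
  by rewrite -!fibprodE e'.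
move=> u x xu; have [u1 u2] := val_in u.
have x1 : gdom G1 x = chom0 (couple_phi c1) (gdom (couple_gpd c1) (fibprod1 (\val u))).
  by rewrite xu; apply: set_type_inj => /=; rewrite unit_val.
have [k1 k1u k1x] := s1 _ _ x1.
have x2 : gdom G2 (couple_psi c1 k1) =
    chom0 (couple_phi c2) (gdom (couple_gpd c2) (fibprod2 (\val u))).
  rewrite chom_dom k1u; apply: set_type_inj => /=.
  by rewrite !unit_val // fibprodE.
have [k2 k2u k2x] := s2 _ _ x2.
exists (fpair (esym k2x)) => //.
apply: set_type_inj; apply: fibprod_eq; rewrite /fibprod1 /fibprod2 /=.
  by rewrite k1u unit_val.
by rewrite k2u unit_val.
Qed.

Lemma couple_comp_psi_inj : injective (chom0 psi).
Proof.
move=> u v e; have [u1 u2] := val_in u; have [v1 v2] := val_in v.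
have e2 : fibprod2 (\val u) = fibprod2 (\val v).
  rewrite -(unit_val u2) -(unit_val v2); congr (\val _).
  apply: (couple_psi_inj c2); apply: set_type_inj => /=.
  by rewrite !unit_val //; have /(congr1 (fun z => \val z)) := e.
apply: set_type_inj; apply: fibprod_eq => //.
rewrite -(unit_val u1) -(unit_val v1); congr (\val _).
apply: (couple_psi_inj c1); apply: set_type_inj => /=.
by rewrite !unit_val // !fibprodE e2.
Qed.

Lemma couple_comp_psi_open : open_map (chom0 psi).
Proof.
move=> _ [_ [O oO <-] <-]; apply: open_local => _ [u Ou <-].
have [A [B [oA oB Au Bu AB]]] := open_prodP oO Ou.
have [u1 u2] := val_in u.
pose A0 : set (units (couple_gpd c1)) := (fun x : units _ => \val x) @^-1` A.
have oA0 : open A0 by exists A.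
pose B0 : set (units (couple_gpd c2)) :=
  ((fun x : units _ => \val x) @^-1` B) `&`
  (chom0 (couple_phi c2) @^-1` (chom0 (couple_psi c1) @` A0)).
have oB0 : open B0.
  apply: openI; first by exists B.
  have oA1 := couple_psi_open c1 _ oA0.
  by have /continuousP/(_ _ oA1) := chom0_continuous (couple_phi c2).
exists (chom0 (couple_psi c2) @` B0); split.
- exact: couple_psi_open.
- exists (gdom _ (fibprod2 (\val u))).
    split; first by rewrite /= unit_val.
    exists (gdom _ (fibprod1 (\val u))); first by rewrite /A0 /= unit_val.
    by apply: set_type_inj => /=; rewrite !unit_val // fibprodE.
  by apply: set_type_inj => /=; rewrite unit_val.
- move=> _ [y [By [x Ax /(congr1 (fun z => \val z)) /= e]] <-].
  pose k : K := fpair e.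
  have ku : fibprod_units k by split; exact: val_in.
  exists (exist _ k (mem_set ku)); first exact: AB.
  exact: set_type_inj.
Qed.

Definition couple_comp : couple G1 G3 :=
  Couple couple_comp_phi_bij couple_comp_psi_open couple_comp_psi_inj.

End CoupleComp.

Section CoupleId.
Context (G : etale_groupoid).

Lemma chom0_id (u : units G) : chom0 (chom_id G) u = u.
Proof. exact: set_type_inj. Qed.

Lemma couple_id_phi_bij : fibrewise_bijective (chom_id G).
Proof. by apply/fibrewiseP; split=> // u x; rewrite chom0_id; exists x. Qed.

Lemma couple_id_psi_open : open_map (chom0 (chom_id G)).
Proof.
move=> U; congr open; apply/seteqP; split=> [u Uu|_ [u Uu <-]].
  by exists u => //; rewrite chom0_id.
by rewrite chom0_id.
Qed.

Lemma couple_id_psi_inj : injective (chom0 (chom_id G)).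
Proof. by move=> u v; rewrite !chom0_id. Qed.

Definition couple_id : couple G G :=
  Couple couple_id_phi_bij couple_id_psi_open couple_id_psi_inj.

End CoupleId.

Lemma couple_comp_equiv (G1 G2 G3 : etale_groupoid)
    (c2 d2 : couple G2 G3) (c1 d1 : couple G1 G2) :
  couple_equiv c2 d2 -> couple_equiv c1 d1 ->
  couple_equiv (couple_comp c2 c1) (couple_comp d2 d1).
Proof.
move=> [i2 [j2 [ij2 ji2 p2 q2]]] [i1 [j1 [ij1 ji1 p1 q1]]].
pose f1 := fproj1 (couple_psi c1) (couple_phi c2).
pose f2 := fproj2 (couple_psi c1) (couple_phi c2).
have e k : couple_psi d1 (chom_comp i1 f1 k) = couple_phi d2 (chom_comp i2 f2 k).
  by rewrite /= q1 p2 fibprodE.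
pose g1 := fproj1 (couple_psi d1) (couple_phi d2).
pose g2 := fproj2 (couple_psi d1) (couple_phi d2).
have e' k : couple_psi c1 (chom_comp j1 g1 k) = couple_phi c2 (chom_comp j2 g2 k).
  by rewrite /= -q1 -p2 ji1 ji2 fibprodE.
exists (flift e), (flift e'); split=> k.
- by apply: fibprod_eq; [exact: ij1|exact: ij2].
- by apply: fibprod_eq; [exact: ji1|exact: ji2].
- by rewrite /= p1.
- by rewrite /= q2.
Qed.

Lemma couple_comp1 (G H : etale_groupoid) (c : couple G H) :
  couple_equiv (couple_comp (couple_id H) c) c.
Proof.
have e k : couple_psi c (chom_id (couple_gpd c) k) =
           couple_phi (couple_id H) (couple_psi c k) by [].
exists (fproj1 _ _), (flift e); split=> //= k.
  by apply: fibprod_eq => //; have := fibprodE k.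
by have := fibprodE k.
Qed.

Lemma couple_compr1 (G H : etale_groupoid) (c : couple G H) :
  couple_equiv (couple_comp c (couple_id G)) c.
Proof.
have e k : couple_psi (couple_id G) (couple_phi c k) =
           couple_phi c (chom_id (couple_gpd c) k) by [].
exists (fproj2 _ _), (flift e); split=> //= k.
  by apply: fibprod_eq => //; have := fibprodE k.
by have := fibprodE k.
Qed.

Lemma couple_compA (G1 G2 G3 G4 : etale_groupoid)
    (c3 : couple G3 G4) (c2 : couple G2 G3) (c1 : couple G1 G2) :
  couple_equiv (couple_comp c3 (couple_comp c2 c1))
               (couple_comp (couple_comp c3 c2) c1).
Proof.
pose a := fproj1 (couple_psi c1) (couple_phi c2).
pose b := fproj2 (couple_psi c1) (couple_phi c2).
pose p := fproj1 (couple_psi (couple_comp c2 c1)) (couple_phi c3).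
pose q := fproj2 (couple_psi (couple_comp c2 c1)) (couple_phi c3).
have e1 k : couple_psi c2 (chom_comp b p k) = couple_phi c3 (q k).
  exact: fibprodE k.
have e2 k : couple_psi c1 (chom_comp a p k) =
    couple_phi (couple_comp c3 c2) (flift e1 k).
  exact: (fibprodE (p k)).
pose a' := fproj1 (couple_psi c2) (couple_phi c3).
pose b' := fproj2 (couple_psi c2) (couple_phi c3).
pose p' := fproj1 (couple_psi c1) (couple_phi (couple_comp c3 c2)).
pose q' := fproj2 (couple_psi c1) (couple_phi (couple_comp c3 c2)).
have e1' k : couple_psi c1 (p' k) = couple_phi c2 (chom_comp a' q' k).
  exact: fibprodE k.
have e2' k : couple_psi (couple_comp c2 c1) (flift e1' k) =
    couple_phi c3 (chom_comp b' q' k).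
  exact: (fibprodE (q' k)).
exists (flift e2), (flift e2'); split=> // k.
  by apply: fibprod_eq => //; apply: fibprod_eq.
by apply: fibprod_eq => //; apply: fibprod_eq.
Qed.

(** Equivalence classes are plain predicates: the universe of [set] is too small
    for [set (couple G H)]. *)
Section CoupleClasses.
Context {G H : etale_groupoid}.

Definition couple_class_of (c : couple G H) : couple G H -> Prop :=
  fun c' => couple_equiv c c'.

Record couple_class := CoupleClass {
  class_set : couple G H -> Prop;
  class_setP : exists c, class_set = couple_class_of c
}.

Definition eclass (c : couple G H) : couple_class :=
  CoupleClass (ex_intro _ c erefl).

Lemma couple_class_eq (A B : couple_class) : class_set A = class_set B -> A = B.
Proof. by case: A B => [A a] [B b] /= e; subst B; rewrite (Prop_irrelevance a b). Qed.

Lemma eclass_ex (A : couple_class) : exists c, A = eclass c.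
Proof. by have [c e] := class_setP A; exists c; exact: couple_class_eq. Qed.

Lemma class_of_eq c d : couple_equiv c d -> couple_class_of c = couple_class_of d.
Proof.
move=> cd; apply/funext => x; apply/propext; split.
  by apply: couple_equiv_trans; exact: couple_equiv_sym.
exact: couple_equiv_trans.
Qed.

Lemma eclass_eq c d : eclass c = eclass d <-> couple_equiv c d.
Proof.
split=> [/(congr1 class_set) /= e|/class_of_eq e]; last exact: couple_class_eq.
by have : couple_class_of d d by [exact: couple_equiv_refl]; rewrite -e.
Qed.

End CoupleClasses.
Arguments couple_class : clear implicits.

Definition class_comp_set (G1 G2 G3 : etale_groupoid)
    (B : couple_class G2 G3) (A : couple_class G1 G2) :
    couple G1 G3 -> Prop :=
  fun c => exists c1 c2, [/\ class_set A c1, class_set B c2 &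
                             couple_equiv (couple_comp c2 c1) c].

Lemma class_comp_setE (G1 G2 G3 : etale_groupoid)
    (c2 : couple G2 G3) (c1 : couple G1 G2) :
  class_comp_set (eclass c2) (eclass c1) = couple_class_of (couple_comp c2 c1).
Proof.
apply/funext => c; apply/propext; split.
  move=> [d1 [d2 [cd1 cd2]]]; apply: couple_equiv_trans.
  exact: couple_comp_equiv.
by move=> h; exists c1, c2; split=> //; exact: couple_equiv_refl.
Qed.

Lemma class_comp_subproof (G1 G2 G3 : etale_groupoid)
    (B : couple_class G2 G3) (A : couple_class G1 G2) :
  exists c, class_comp_set B A = couple_class_of c.
Proof.
have [c2 ->] := eclass_ex B; have [c1 ->] := eclass_ex A.
by exists (couple_comp c2 c1); exact: class_comp_setE.
Qed.

Definition class_comp (G1 G2 G3 : etale_groupoid)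
    (B : couple_class G2 G3) (A : couple_class G1 G2) : couple_class G1 G3 :=
  CoupleClass (class_comp_subproof B A).

Lemma class_compE (G1 G2 G3 : etale_groupoid)
    (c2 : couple G2 G3) (c1 : couple G1 G2) :
  class_comp (eclass c2) (eclass c1) = eclass (couple_comp c2 c1).
Proof. by apply: couple_class_eq; exact: class_comp_setE. Qed.

Lemma class_compA (G1 G2 G3 G4 : etale_groupoid)
    (C : couple_class G3 G4) (B : couple_class G2 G3) (A : couple_class G1 G2) :
  class_comp C (class_comp B A) = class_comp (class_comp C B) A.
Proof.
have [c3 ->] := eclass_ex C; have [c2 ->] := eclass_ex B.
have [c1 ->] := eclass_ex A; rewrite !class_compE.
exact/eclass_eq/couple_compA.
Qed.

Lemma class_comp1m (G H : etale_groupoid) (A : couple_class G H) :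
  class_comp (eclass (couple_id H)) A = A.
Proof.
have [c ->] := eclass_ex A; rewrite class_compE.
exact/eclass_eq/couple_comp1.
Qed.

Lemma class_compm1 (G H : etale_groupoid) (A : couple_class G H) :
  class_comp A (eclass (couple_id G)) = A.
Proof.
have [c ->] := eclass_ex A; rewrite class_compE.
exact/eclass_eq/couple_compr1.
Qed.

Definition EG : category :=
  @Category etale_groupoid couple_class (fun G => eclass (couple_id G))
    class_comp class_compA class_comp1m class_compm1.

Section CoupleUnitMap.
Context {G H : etale_groupoid} (c : couple G H).

Let K := couple_gpd c.
Let phi0 : partial_map (units K) (units G) :=
  pm_restrict (chom0_continuous (couple_phi c)) (@openT (units K)).
Let psi0 : partial_map (units K) (units H) :=
  pm_restrict (chom0_continuous (couple_psi c)) (@openT (units K)).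

Lemma couple_psi0_fun_inj : injective (pm_fun psi0).
Proof. by move=> u v /(couple_psi_inj c) /set_type_inj. Qed.

Lemma couple_psi0_fun_open : open_map (pm_fun psi0).
Proof. exact: open_mapS (couple_psi_open c) (@openT _). Qed.

(** [phi0 o psi0^-1], with domain [psi0 (K0)]. *)
Definition couple_unit_map : partial_map (units H) (units G) :=
  pm_comp phi0 (pm_inv couple_psi0_fun_inj couple_psi0_fun_open).

End CoupleUnitMap.

(* Main.v *)
Require Import Defs.
From mathcomp Require Import all_boot all_classical.
From mathcomp Require Import topology_structure subtype_topology.

(** Fix a couple morphism [(phi, psi; K) : G -> H].

    For an open bisection [U] of [G], the set [phi^-1 U] is open, and [psi] is
    an open map because [psi^(0)] is one and [d] is a local homeomorphism on
    both sides ([chom_open]); so [psi (phi^-1 U)] is open.  An arrow [k] of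
    [phi^-1 U] is determined by [d k], since [d k] determines [d (phi k)],
    hence [phi k] because [U] is a bisection, hence [k] because [phi] is
    injective on fibres; the same holds for [r] after inverting arrows.  As
    [psi^(0)] is injective, [d] and [r] remain injective on [psi (phi^-1 U)].

    The map [U |-> psi (phi^-1 U)] is multiplicative ([couple_bisM]) for two
    reasons.  Injectivity of [psi^(0)] makes [k] and [l] composable as soon as
    [psi k] and [psi l] are; and a factorisation [phi k = u v] lifts to [K],
    because fibrewise surjectivity yields [l] with [d l = d k] and [phi l = v],
    whence [k = (k l^-1) l] and [phi (k l^-1) = u].  The two axioms of an
    action morphism follow from the same lifting: an arrow [g] of [U] starting
    at [phi^(0) u] is [phi k] for some [k] starting at [u], and then [k]
    witnesses both sides of the equivariance condition at [psi^(0) u].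

    Both components depend only on the relations [(phi k, psi k)] for arrows
    [k], respectively units [k], of [K] ([couple_unit_mapP]).  Equivalent
    couples define the same relations, the identity couple defines equality,
    and the fibre product [K1 x_(G2) K2] is built precisely so that its
    relation is the composite of the two given ones.  This gives
    well-definedness on classes and functoriality. *)

Set Implicit Arguments.
Unset Strict Implicit.
Unset Printing Implicit Defensive.

Local Open Scope classical_set_scope.

(** * Homomorphisms of etale groupoids *)

(** Near a given arrow [f x], an arrow of [H] is determined by its domain; so
    the image of a small open set [W] around [x] is, locally, the preimage
    under [d] of the open set [f^(0) (d W)]. *)
Lemma chom_open {G H : etale_groupoid} (f : chom G H) :
  open_map (chom0 f) -> open_map f.
Proof.
move=> of0 W oW; apply: open_local => _ [x Wx <-].
have [N [oN Nfx Ni]] := gdom_local_inj (f x).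
pose W' : set G := W `&` f @^-1` N.
have oW' : open W'.
  by apply: openI => //; have /continuousP := chom_continuous f; exact.
exists (N `&` (gdom H @^-1` (chom0 f @` (gdom G @` W')))); split.
- apply: openI => //; have /continuousP := @gdom_continuous H; apply.
  by apply: of0; exact: gdom_open.
- by split=> //; exists (gdom G x); [exists x|rewrite chom_dom].
- move=> n [Nn [_ [w [Ww Nw] <-] e]]; exists w => //.
  by apply: Ni => //; rewrite chom_dom.
Qed.

Section FibrewiseBijective.
Context {G H : etale_groupoid} (f : chom G H) (fb : fibrewise_bijective f).

Lemma fibrewise_inj g h : gdom G g = gdom G h -> f g = f h -> g = h.
Proof. by have /fibrewiseP[+ _] := fb; exact. Qed.

(** Inversion exchanges the fibres of [r] and those of [d]. *)
Lemma fibrewise_inj_rng g h : grng G g = grng G h -> f g = f h -> g = h.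
Proof.
move=> e fgh; rewrite -(ginvK (G := G) g) -(ginvK (G := G) h); congr (ginv G _).
by apply: fibrewise_inj; rewrite ?gdom_inv ?chom_inv ?fgh.
Qed.

Lemma fibrewise_lift (u : units G) x :
  gdom H x = chom0 f u -> exists2 g, gdom G g = u & f g = x.
Proof. by have /fibrewiseP[_] := fb; exact. Qed.

(** The right factor lifts by surjectivity on the fibre of [k]; the left factor
    is then forced to be [k l^-1]. *)
Lemma fibrewise_factor k u v : gprod H u v (f k) ->
  exists m l, [/\ gprod G m l k, f m = u & f l = v].
Proof.
move=> p; have [|l lk lv] := @fibrewise_lift (gdom G k) v.
  by rewrite -(gprod_dom p) chom_dom.
have [m km] : exists m, gprod G k (ginv G l) m.
  by apply: gprod_ex; rewrite grng_inv.
exists m, l; split=> //.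
  by have := gprod_invr km; rewrite ginvK.
have := chom_mul f km; rewrite chom_inv lv => q.
exact: gprod_fun q (gprod_invr p).
Qed.

End FibrewiseBijective.

(** * The action morphism of a couple *)

Section CoupleAction.
Context {G H : etale_groupoid} (c : couple G H).

Definition couple_bis_set (U : set G) : set H :=
  couple_psi c @` (couple_phi c @^-1` U).

Lemma couple_bis_open (U : bis G) : open (couple_bis_set (bis_set U)).
Proof.
apply: chom_open (couple_psi_open c) _ _.
have /continuousP := chom_continuous (couple_phi c); apply; exact: bis_open.
Qed.

Lemma couple_bis_dom_inj (U : bis G) :
  set_inj (couple_bis_set (bis_set U)) (gdom H).
Proof.
apply/set_injP => _ _ [k Uk <-] [l Ul <-].
rewrite !chom_dom => /(couple_psi_inj c) e.
suff -> : k = l by [].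
apply: (fibrewise_inj (couple_phi_bij c)) => //.
by apply: (bis_domI Uk Ul); rewrite !chom_dom e.
Qed.

Lemma couple_bis_rng_inj (U : bis G) :
  set_inj (couple_bis_set (bis_set U)) (grng H).
Proof.
apply/set_injP => _ _ [k Uk <-] [l Ul <-].
rewrite !chom_rng => /(couple_psi_inj c) e.
suff -> : k = l by [].
apply: (fibrewise_inj_rng (couple_phi_bij c)) => //.
by apply: (bis_rngI Uk Ul); rewrite !chom_rng e.
Qed.

Definition couple_bis (U : bis G) : bis H :=
  Bis (@couple_bis_open U) (@couple_bis_dom_inj U) (@couple_bis_rng_inj U).

Lemma couple_bisM : {morph couple_bis : U V / (U * V)%g}.
Proof.
move=> U V; apply: bis_eq; apply/seteqP; split.
  move=> _ [k [u [v [Uu Vv p]]] <-].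
  have [m [l [q mu lv]]] := fibrewise_factor (couple_phi_bij c) p.
  exists (couple_psi c m), (couple_psi c l); split; last exact: chom_mul.
    by exists m => //=; rewrite mu.
  by exists l => //=; rewrite lv.
move=> w [_ [_ [[k Uk <-] [l Vl <-] p]]].
have [x q] : exists x, gprod (couple_gpd c) k l x.
  apply: gprod_ex; apply: (couple_psi_inj c).
  by rewrite -chom_dom -chom_rng (gprod_comp p).
exists x; last exact: gprod_fun (chom_mul _ q) p.
by exists (couple_phi c k), (couple_phi c l); split=> //; exact: chom_mul.
Qed.

Lemma couple_unit_mapP y x : pm_graph (couple_unit_map c) y x <->
  exists2 u, chom0 (couple_psi c) u = y & chom0 (couple_phi c) u = x.
Proof.
split=> [/pm_compP[u /pm_invP/pm_restrictP[_ uy] /pm_restrictP[_ ux]]|[u uy ux]].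
  by exists u.
apply/pm_compP; exists u; first by apply/pm_invP/pm_restrictP.
by apply/pm_restrictP.
Qed.

(** Both axioms of an action morphism reduce to this: the arrow of [U] starting
    at [phi^(0) u] lifts to an arrow [k] of the groupoid of the couple starting
    at [u], by fibrewise surjectivity of [phi]. *)
Lemma couple_preimage_lift (U : bis G) y :
  pm_preimage (couple_unit_map c) (pm_dom (slice_map U)) y <->
  exists2 k, bis_set U (couple_phi c k) & gdom H (couple_psi c k) = y.
Proof.
split.
  move=> /pm_preimageP[x /couple_unit_mapP[u <- <-] /pm_graph_ex[z]].
  move=> /slice_partial_mapP[g [Ug gu _]].
  have [k ku kg] := fibrewise_lift (couple_phi_bij c) gu.
  by exists k; [rewrite kg|rewrite chom_dom ku].
move=> [k Uk <-]; apply/pm_preimageP; exists (gdom G (couple_phi c k)).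
  by apply/couple_unit_mapP; exists (gdom _ k); rewrite chom_dom.
apply: (@pm_graph_dom _ _ _ _ (grng G (couple_phi c k))).
by apply/slice_partial_mapP; exists (couple_phi c k).
Qed.

Lemma couple_action_dom (U : bis G) :
  pm_preimage (couple_unit_map c) (pm_dom (slice_map U)) =
  pm_dom (slice_map (couple_bis U)).
Proof.
apply/seteqP; split=> y.
  move=> /couple_preimage_lift[k Uk <-].
  apply: (@pm_graph_dom _ _ _ _ (grng H (couple_psi c k))).
  by apply/slice_partial_mapP; exists (couple_psi c k); split=> //; exists k.
move=> /pm_graph_ex[z /slice_partial_mapP[_ [[k Uk <-] ky _]]].
by apply/couple_preimage_lift; exists k.
Qed.

Lemma couple_action_equivariant (U : bis G) y :
  pm_preimage (couple_unit_map c) (pm_dom (slice_map U)) y ->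
  exists x, pm_graph (pm_comp (slice_map U) (couple_unit_map c)) y x /\
            pm_graph (pm_comp (couple_unit_map c) (slice_map (couple_bis U))) y x.
Proof.
move=> /couple_preimage_lift[k Uk <-]; exists (grng G (couple_phi c k)).
split; apply/pm_compP.
  exists (gdom G (couple_phi c k)).
    by apply/couple_unit_mapP; exists (gdom _ k); rewrite chom_dom.
  by apply/slice_partial_mapP; exists (couple_phi c k).
exists (grng H (couple_psi c k)).
  by apply/slice_partial_mapP; exists (couple_psi c k); split=> //; exists k.
by apply/couple_unit_mapP; exists (grng _ k); rewrite chom_rng.
Qed.

Definition couple_action : action_morphism (slice_action G) (slice_action H) :=
  @ActionMorphism (slice_action G) (slice_action H) couple_bis
    (couple_unit_map c) couple_bisM couple_action_dom couple_action_equivariant.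

End CoupleAction.

(** * Functoriality *)

Lemma couple_action_eq (G H : etale_groupoid) (c : couple G H)
    (m : action_morphism (slice_action G) (slice_action H)) :
  (forall U : bis G, couple_bis_set c (bis_set U) = bis_set (am_hom m U)) ->
  (forall y x, pm_graph (couple_unit_map c) y x <-> pm_graph (am_map m) y x) ->
  couple_action c = m.
Proof.
move=> eU ex; apply: action_morphism_eq; last exact: partial_map_eq.
by apply/funext => U; apply: bis_eq; exact: eU.
Qed.

Section EquivalentCouples.
Context {G H : etale_groupoid}.
Implicit Types c : couple G H.

(* One half of an isomorphism of couples gives one inclusion; the other one
   follows by symmetry. *)
Lemma couple_equiv_bis_sub c1 c2 (U : set G) : couple_equiv c1 c2 ->
  couple_bis_set c1 U `<=` couple_bis_set c2 U.
Proof.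
move=> [i [_ [_ _ ephi epsi]]] _ [k Uk <-].
by exists (i k); rewrite /= ?ephi ?epsi.
Qed.

Lemma couple_equiv_unit_sub c1 c2 y x : couple_equiv c1 c2 ->
  pm_graph (couple_unit_map c1) y x -> pm_graph (couple_unit_map c2) y x.
Proof.
move=> [i [_ [_ _ ephi epsi]]] /couple_unit_mapP[u <- <-].
apply/couple_unit_mapP; exists (chom0 i u); apply: set_type_inj => /=.
  exact: epsi.
exact: ephi.
Qed.

Lemma couple_equiv_action c1 c2 :
  couple_equiv c1 c2 -> couple_action c1 = couple_action c2.
Proof.
move=> e; have e' := couple_equiv_sym e.
apply: couple_action_eq => [U|y x]; last by split; exact: couple_equiv_unit_sub.
by apply/seteqP; split; exact: couple_equiv_bis_sub.
Qed.

End EquivalentCouples.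

Lemma couple_action_id (G : etale_groupoid) :
  couple_action (couple_id G) = am_id (slice_action G).
Proof.
apply: couple_action_eq => [U|y x]; first exact: image_id.
split=> [/couple_unit_mapP[u <- <-]|/pm_idP <-]; first by apply/pm_idP.
by apply/couple_unit_mapP; exists y; rewrite chom0_id.
Qed.

(** The fibre product consists of the pairs [(k1, k2)] through which an arrow of
    [G1] is related to one of [G3] via the common arrow [psi1 k1 = phi2 k2]; so
    its relation is the composite of the two relations, on arrows and on
    units. *)
Lemma couple_action_comp (G1 G2 G3 : etale_groupoid)
    (c2 : couple G2 G3) (c1 : couple G1 G2) :
  couple_action (couple_comp c2 c1) =
  am_comp (couple_action c2) (couple_action c1).
Proof.
apply: couple_action_eq => [U|z x].
  apply/seteqP; split.
    move=> _ [k Uk <-]; exists (fibprod2 k) => //.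
    by exists (fibprod1 k) => //; exact: fibprodE.
  by move=> _ [k2 [k1 Uk1 e] <-]; exists (fpair e).
split.
  move=> /couple_unit_mapP[u <- <-]; have [u1 u2] := val_in u.
  apply/pm_compP.
  exists (chom0 (couple_phi c2) (gdom _ (fibprod2 (\val u)))).
    apply/couple_unit_mapP; exists (gdom _ (fibprod2 (\val u))) => //.
    by apply: set_type_inj; rewrite /= unit_val.
  apply/couple_unit_mapP; exists (gdom _ (fibprod1 (\val u))).
    by apply: set_type_inj; rewrite /= !unit_val // fibprodE.
  by apply: set_type_inj; rewrite /= unit_val.
move=> /pm_compP[y /couple_unit_mapP[v2 <- v2y] /couple_unit_mapP[v1 v1y <-]].
have e : couple_psi c1 (\val v1) = couple_phi c2 (\val v2).
  by have := congr1 (fun t : units G2 => \val t) (etrans v1y (esym v2y)).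
have eu : fibprod_units (fpair e) by split; exact: val_in.
by apply/couple_unit_mapP; exists (exist _ (fpair e) (mem_set eu));
  exact: set_type_inj.
Qed.

Definition class_action (G H : etale_groupoid) (A : couple_class G H) :
    action_morphism (slice_action G) (slice_action H) :=
  couple_action (sval (cid (eclass_ex A))).

Lemma class_actionE (G H : etale_groupoid) (c : couple G H) :
  class_action (eclass c) = couple_action c.
Proof.
rewrite /class_action; case: (cid _) => c' /= /eclass_eq e.
exact/couple_equiv_action/couple_equiv_sym.
Qed.

Theorem theorem5p10 :
  exists F : forall G H : EG,
      @hom EG G H -> @hom ISA (slice_action G) (slice_action H),
    @is_functor EG ISA slice_action F /\
    forall (G H : etale_groupoid) (c : couple G H),
      (forall U : bis G,
         bis_set (am_hom (F G H (eclass c)) U) =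
         couple_psi c @` (couple_phi c @^-1` bis_set U)) /\
      am_map (F G H (eclass c)) = couple_unit_map c.
Proof.
exists class_action; split; last by move=> G H c; rewrite class_actionE.
split=> [G|G1 G2 G3 B A].
  by rewrite /= class_actionE couple_action_id.
have [c2 ->] := eclass_ex B; have [c1 ->] := eclass_ex A.
by rewrite /= class_compE !class_actionE couple_action_comp.
Qed.
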